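(* Let $\phi \in \mathcal{S}(\mathcal{G}_\delta)$, let $u$ be a $\delta$ nc-model for $\phi$ with values in $\mathcal{L}(\mathbb{C},\mathcal{E}\otimes\mathbb{C}^J)$, and let $\begin{pmatrix}A&B\\C&D\end{pmatrix}$ be a realization of this model. Let $T \in \mathcal{I}_\delta\cap\mathbb{M}_n^d$, and assume that the transverse inward set $\Delta(T)$ is non-empty. Then $T$ is a B-point for $\phi$ if and only if $$C\otimes I_{\mathbb{C}^n} \ \in \ \mathrm{Ran}\left[I - (D\otimes I_{\mathbb{C}^n})(I_{\mathcal{E}}\otimes \delta(T)) \right].$$
   Context: $\mathbb{M}_n$ is the set of $n\times n$ complex matrices, $\mathbb{M}^{[d]} = \bigcup_{n\ge 1} \mathbb{M}_n^d$, and $\|x\|=\max_r\|x^r\|$ for $x\in\mathbb{M}_n^d$. $\delta$ is a $J\times J$ matrix whose entries are non-commutative polynomials in $d$ variables; for $x\in\mathbb{M}_n^d$, $\delta(x)$ is an operator on $\mathbb{C}^J\otimes\mathbb{C}^n$ with the operator norm. $\mathcal{G}_\delta = \bigcup_{n\ge1}\{x\in\mathbb{M}_n^d : \|\delta(x)\|<1\}$; $\mathcal{B}_\delta$ is its topological boundary (in each $\mathbb{M}_n^d$); $\mathcal{I}_\delta=\{x\in\mathcal{B}_\delta: \delta(x)\text{ is an isometry}\}$. An nc-function on $\mathcal{G}_\delta$ is a graded function $\phi$ ($x\in\mathbb{M}_n^d\Rightarrow\phi(x)\in\mathbb{M}_n$) with $\phi(x\oplus y)=\phi(x)\oplus\phi(y)$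 and $\phi(s^{-1}xs)=s^{-1}\phi(x)s$ ($s\in\mathbb{M}_n$ invertible, acting componentwise) whenever the arguments on both sides lie in $\mathcal{G}_\delta$. The Schur class $\mathcal{S}(\mathcal{G}_\delta)$ is the set of nc-functions $\phi$ on $\mathcal{G}_\delta$ with $\|\phi(x)\|<1$ for all $x\in\mathcal{G}_\delta$. $T\in\mathcal{B}_\delta\cap\mathbb{M}_n^d$ is a B-point for $\phi$ if $\lim_{j\to\infty}\frac{\|I-\phi(Z_j)^*\phi(Z_j)\|}{1-\|\delta(Z_j)\|^2}<\infty$ for some sequence $Z_j$ in $\mathcal{G}_\delta\cap\mathbb{M}_n^d$ converging to $T$. For a Hilbert space $\mathcal{E}$, a $\delta$ nc-model for $\phi$ is an $\mathcal{L}(\mathbb{C},\mathcal{E}\otimes\mathbb{C}^J)$-valued nc function $u$ on $\mathcal{G}_\delta$, i.e. $u(x)\in\mathcal{L}(\mathbb{C}^n,\mathcal{E}\otimes\mathbb{C}^J\otimes\mathbb{C}^n)$ for $x\in\mathcal{G}_\delta\cap\mathbb{M}_n^d$, $u(x\oplus y)=u(x)\oplus u(y)$, $u(s^{-1}xs)=(I_{\mathcal{E}\otimes\mathbb{C}^J}\otimes s^{-1})u(x)s$ whenever $x,s^{-1}xs\in\mathcal{G}_\delta$, such that for all $n$ and $x,y\in\mathcal{G}_\delta\cap\mathbb{M}_n^d$ $$I_{\mathbb{C}^n}-\phi(y)^*\phi(x)=u(y)^*\big(I_{\mathcal{E}}\otimes(I_{\mathbb{C}^J\otimes\mathbb{C}^n}-\delta(y)^*\delta(x))\big)u(x).$$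 A realization of the model $u$ is an isometry $\begin{pmatrix}A&B\\C&D\end{pmatrix}:\mathbb{C}\oplus(\mathcal{E}\otimes\mathbb{C}^J)\to\mathbb{C}\oplus(\mathcal{E}\otimes\mathbb{C}^J)$ such that for all $n$ and $x\in\mathcal{G}_\delta\cap\mathbb{M}_n^d$ $$\big[I-(D\otimes I_{\mathbb{C}^n})(I_{\mathcal{E}}\otimes\delta(x))\big]u(x)=C\otimes I_{\mathbb{C}^n},\qquad \phi(x)=A\otimes I_{\mathbb{C}^n}+(B\otimes I_{\mathbb{C}^n})(I_{\mathcal{E}}\otimes\delta(x))u(x).$$ For $T\in\mathcal{I}_\delta\cap\mathbb{M}_n^d$ and $H\in\mathbb{M}_n^d$, $\nabla\delta(T)[H]=\lim_{t\to0}\frac1t[\delta(T+tH)-\delta(T)]$, and $\Delta(T)=\{H\in\mathbb{M}_n^d:\|H\|\le1,\ \delta(T)^*\nabla\delta(T)[H]<0\}$, where $A<0$ means $A$ is self-adjoint and negative definite. The condition $C\otimes I_{\mathbb{C}^n}\in\mathrm{Ran}[L]$, for an operator $L$ on $\mathcal{E}\otimes\mathbb{C}^J\otimes\mathbb{C}^n$, means that there is $v\in\mathcal{L}(\mathbb{C}^n,\mathcal{E}\otimes\mathbb{C}^J\otimes\mathbb{C}^n)$ with $Lv=C\otimes I_{\mathbb{C}^n}$. *)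

(* Defs.v *)
From HB Require Import structures.
From mathcomp Require Import all_boot all_order all_algebra.
From mathcomp Require Import finmap complex sesquilinear spectral.
From mathcomp Require Import all_classical all_reals all_analysis.
From mathcomp Require monalg.
(* The notations of monalg cannot be loaded together with those of
   mathcomp-analysis. *)
Import -(notations) monalg.

Set Implicit Arguments.
Unset Strict Implicit.
Unset Printing Implicit Defensive.

Import Order.TTheory GRing.Theory Num.Theory.
Import numFieldNormedType.Exports.

Local Open Scope classical_set_scope.
Local Open Scope ring_scope.
Local Open Scope sesquilinear_scope.

(* The usual topology of the complex plane: R[i] normed by its modulus. *)
HB.instance Definition _ (R : realType) := NormedModule.copy R[i] R[i]^o.

Definition vnorm (R : realType) (m : nat) (v : 'cV[R[i]]_m) : R :=
  Num.sqrt (\sum_i complex.Re `|v i 0| ^+ 2).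

Definition opnorm (R : realType) (p m : nat) (M : 'M[R[i]]_(p, m)) : R :=
  sup [set vnorm (M *m v) | v in [set v : 'cV[R[i]]_m | vnorm v <= 1]].

Definition negdef (R : realType) (m : nat) (M : 'M[R[i]]_m) : Prop :=
  M ^t* = M /\ forall v : 'cV[R[i]]_m, v != 0 -> (v ^t* *m M *m v) 0 0 < 0.

(* d-tuples of n x n matrices; {ptws _ -> _} carries the product topology,
   which is the one induced by the norm tupnorm. *)
Definition mtuple (R : realType) (d n : nat) : topologicalType :=
  {ptws 'I_d -> 'M[R[i]]_n}.

Definition tupnorm (R : realType) (d n : nat) (x : mtuple R d n) : R :=
  \big[Num.max/0]_(r < d) opnorm (x r).

Definition tupdsum (R : realType) (d n m : nat)
    (x : mtuple R d n) (y : mtuple R d m) : mtuple R d (n + m) :=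
  fun r => block_mx (x r) 0 0 (y r).

Definition tupsim (R : realType) (d n : nat) (s : 'M[R[i]]_n)
    (x : mtuple R d n) : mtuple R d n :=
  fun r => invmx s *m x r *m s.

(* Non-commutative polynomials in d variables: the algebra over the complex
   numbers of the free monoid on 'I_d. *)
Definition ncpoly (R : realType) (d : nat) := malg (fmonom 'I_d) R[i].

Definition nceval (R : realType) (d n : nat) (p : ncpoly R d)
    (x : mtuple R d n) : 'M[R[i]]_n :=
  \sum_(w <- msupp p) mcoeff w p *: \prod_(i <- fmonom_val w) x i.

(* delta(x), as an operator on C^J (x) C^n: the J x J block matrix whose
   (i, j) block is the n x n matrix delta_ij(x). *)
Definition deval (R : realType) (d J n : nat) (delta : 'M[ncpoly R d]_J)
    (x : mtuple R d n) : 'M[R[i]]_(\sum_(i < J) n) :=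
  \mxblock_(i < J, j < J) nceval (delta i j) x.

Definition Gdelta (R : realType) (d J : nat) (delta : 'M[ncpoly R d]_J)
    (n : nat) : set (mtuple R d n) :=
  [set x | (0 < n)%N /\ opnorm (deval delta x) < 1].

Definition Bdelta (R : realType) (d J : nat) (delta : 'M[ncpoly R d]_J)
    (n : nat) : set (mtuple R d n) :=
  closure (Gdelta delta (n := n)) `\` interior (Gdelta delta (n := n)).

Definition Idelta (R : realType) (d J : nat) (delta : 'M[ncpoly R d]_J)
    (n : nat) : set (mtuple R d n) :=
  [set T | Bdelta delta T /\ forall v, vnorm (deval delta T *m v) = vnorm v].

(* Graded matrix-valued functions are total functions; only their values on
   Gdelta matter. *)
Definition gradedfun (R : realType) (d : nat) : Type :=
  forall n : nat, mtuple R d n -> 'M[R[i]]_n.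

Definition nc_function (R : realType) (d J : nat) (delta : 'M[ncpoly R d]_J)
    (phi : gradedfun R d) : Prop :=
  (forall (n m : nat) (x : mtuple R d n) (y : mtuple R d m),
     Gdelta delta x -> Gdelta delta y -> Gdelta delta (tupdsum x y) ->
     phi _ (tupdsum x y) = block_mx (phi n x) 0 0 (phi m y)) /\
  (forall (n : nat) (s : 'M[R[i]]_n) (x : mtuple R d n), s \in unitmx ->
     Gdelta delta x -> Gdelta delta (tupsim s x) ->
     phi n (tupsim s x) = invmx s *m phi n x *m s).

Definition schur_class (R : realType) (d J : nat) (delta : 'M[ncpoly R d]_J)
    (phi : gradedfun R d) : Prop :=
  nc_function delta phi /\
  (forall (n : nat) (x : mtuple R d n), Gdelta delta x -> opnorm (phi n x) < 1).

Definition B_point (R : realType) (d J : nat) (delta : 'M[ncpoly R d]_J)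
    (phi : gradedfun R d) (n : nat) (T : mtuple R d n) : Prop :=
  Bdelta delta T /\
  exists Z : nat -> mtuple R d n,
    [/\ forall j, Gdelta delta (Z j),
        Z @ \oo --> T &
        cvgn (fun j => opnorm (1%:M - (phi n (Z j)) ^t* *m phi n (Z j))
                       / (1 - opnorm (deval delta (Z j)) ^+ 2))].

(* Complex Hilbert spaces: Banach spaces whose norm comes from an inner product.
   The inner product is linear in its first argument and conjugate-linear in
   the second one. *)
Record hilbertType (R : realType) : Type := Hilbert {
  hspace :> completeNormedModType R[i];
  hdot : {dot hspace for Num.conj};
  hdot_norm : forall x : hspace, `|x| ^+ 2 = hdot x x
}.

(* E (x) C^J and E (x) C^J (x) C^n, in coordinates with respect to the
   canonical bases of C^J and C^n. *)
Definition hvec (R : realType) (E : hilbertType R) (J : nat) :=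
  {ffun 'I_J -> E}.

Definition hten (R : realType) (E : hilbertType R) (J n : nat) :=
  {ffun 'I_J * 'I_n -> E}.

Definition hten_dot (R : realType) (E : hilbertType R) (J n : nat)
    (v w : hten E J n) : R[i] :=
  \sum_p hdot E (v p) (w p).

Definition hvec_sqnorm (R : realType) (E : hilbertType R) (J : nat)
    (v : hvec E J) : R[i] :=
  \sum_j `|v j| ^+ 2.

Definition hslice (R : realType) (E : hilbertType R) (J n : nat)
    (v : hten E J n) (k : 'I_n) : hvec E J :=
  [ffun j => v (j, k)].

Definition hdsum (R : realType) (E : hilbertType R) (J n m : nat)
    (v : hten E J n) (w : hten E J m) : hten E J (n + m) :=
  [ffun p : 'I_J * 'I_(n + m) => match fintype.split p.2 with
             | inl k => v (p.1, k)
             | inr l => w (p.1, l)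
             end].

(* I_E (x) M, for M an operator on C^J (x) C^n *)
Definition idE_tens (R : realType) (E : hilbertType R) (J n : nat)
    (M : 'M[R[i]]_(\sum_(i < J) n)) (v : hten E J n) : hten E J n :=
  [ffun p => \sum_q (submxblock M p.1 q.1) p.2 q.2 *: v q].

(* I_(E (x) C^J) (x) s, for s an operator on C^n *)
Definition idEJ_tens (R : realType) (E : hilbertType R) (J n : nat)
    (s : 'M[R[i]]_n) (v : hten E J n) : hten E J n :=
  [ffun p => \sum_l s p.2 l *: v (p.1, l)].

(* B (x) I, C (x) I and D (x) I, where I is the identity of C^n *)
Definition B_tens (R : realType) (E : hilbertType R) (J n : nat)
    (B : {scalar hvec E J}) (v : hten E J n) : 'cV[R[i]]_n :=
  \col_k B (hslice v k).

Definition C_tens (R : realType) (E : hilbertType R) (J n : nat)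
    (C : {linear R[i]^o -> hvec E J}) (a : 'cV[R[i]]_n) : hten E J n :=
  [ffun p => C (a p.2 0) p.1].

Definition D_tens (R : realType) (E : hilbertType R) (J n : nat)
    (D : {linear hvec E J -> hvec E J}) (v : hten E J n) : hten E J n :=
  [ffun p => D (hslice v p.2) p.1].

(* The adjoint of S : C^n -> E (x) C^J (x) C^n, through the canonical
   orthonormal basis of C^n; see hadjP. *)
Definition hadj (R : realType) (E : hilbertType R) (J n : nat)
    (S : {linear 'cV[R[i]]_n -> hten E J n}) (v : hten E J n) : 'cV[R[i]]_n :=
  \col_k hten_dot v (S (delta_mx k 0)).

Lemma hadjP (R : realType) (E : hilbertType R) (J n : nat)
    (S : {linear 'cV[R[i]]_n -> hten E J n}) (v : hten E J n)
    (a : 'cV[R[i]]_n) :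
  (a ^t* *m hadj S v) 0 0 = hten_dot v (S a).
Proof.
rewrite [a in RHS]matrix_sum_delta; under [in RHS]eq_bigr do rewrite big_ord1.
rewrite linear_sum mxE /hten_dot.
under eq_bigr => i _ do rewrite !mxE /hten_dot mulr_sumr.
rewrite exchange_big /=; apply: eq_bigr => p _.
rewrite sum_ffunE linear_sum; apply: eq_bigr => i _.
by rewrite linearZ /= ffunE linearZ.
Qed.

(* Linear maps out of the finite-dimensional C^n are bounded. *)
Definition hgradedfun (R : realType) (d : nat) (E : hilbertType R) (J : nat) :=
  forall n : nat, mtuple R d n -> {linear 'cV[R[i]]_n -> hten E J n}.

Definition nc_model (R : realType) (d J : nat) (delta : 'M[ncpoly R d]_J)
    (phi : gradedfun R d) (E : hilbertType R) (u : hgradedfun d E J) : Prop :=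
  [/\ forall (n m : nat) (x : mtuple R d n) (y : mtuple R d m)
          (a : 'cV[R[i]]_n) (b : 'cV[R[i]]_m),
        Gdelta delta x -> Gdelta delta y -> Gdelta delta (tupdsum x y) ->
        u _ (tupdsum x y) (col_mx a b) = hdsum (u n x a) (u m y b),
      forall (n : nat) (s : 'M[R[i]]_n) (x : mtuple R d n) (a : 'cV[R[i]]_n),
        s \in unitmx -> Gdelta delta x -> Gdelta delta (tupsim s x) ->
        u n (tupsim s x) a = idEJ_tens (invmx s) (u n x (s *m a)) &
      forall (n : nat) (x y : mtuple R d n) (a : 'cV[R[i]]_n),
        Gdelta delta x -> Gdelta delta y ->
        (1%:M - (phi n y) ^t* *m phi n x) *m a =
        hadj (u n y)
          (idE_tens (1%:M - (deval delta y) ^t* *m deval delta x) (u n x a))].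

(* The isometry condition bounds A, B, C and D. *)
Definition realization (R : realType) (d J : nat) (delta : 'M[ncpoly R d]_J)
    (phi : gradedfun R d) (E : hilbertType R) (u : hgradedfun d E J)
    (A : R[i]) (B : {scalar hvec E J}) (C : {linear R[i]^o -> hvec E J})
    (D : {linear hvec E J -> hvec E J}) : Prop :=
  [/\ forall (z : R[i]) (v : hvec E J),
        `|A * z + B v| ^+ 2 + hvec_sqnorm (C z + D v)
        = `|z| ^+ 2 + hvec_sqnorm v,
      forall (n : nat) (x : mtuple R d n) (a : 'cV[R[i]]_n),
        Gdelta delta x ->
        u n x a - D_tens D (idE_tens (deval delta x) (u n x a)) = C_tens C a &
      forall (n : nat) (x : mtuple R d n) (a : 'cV[R[i]]_n),
        Gdelta delta x ->
        phi n x *m a = A%:M *m a + B_tens B (idE_tens (deval delta x) (u n x a))].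

Definition nabla (R : realType) (d J n : nat) (delta : 'M[ncpoly R d]_J)
    (T H : mtuple R d n) : 'M[R[i]]_(\sum_(i < J) n) :=
  lim ((fun t : R[i] => t^-1 *: (deval delta
          ((fun r => T r + t *: H r) : mtuple R d n) - deval delta T)) @ 0^').

Definition inward (R : realType) (d J n : nat) (delta : 'M[ncpoly R d]_J)
    (T : mtuple R d n) : set (mtuple R d n) :=
  [set H | tupnorm H <= 1 /\ negdef ((deval delta T) ^t* *m nabla delta T H)].

(* K \in Ran[L], in the sense that K factors through L *)
Definition in_Ran (R : realType) (E : hilbertType R) (J n : nat)
    (K : 'cV[R[i]]_n -> hten E J n) (L : hten E J n -> hten E J n) : Prop :=
  exists v : {linear 'cV[R[i]]_n -> hten E J n}, forall a, L (v a) = K a.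

(* Main.v *)
From HB Require Import structures.
Require Import Defs.
From mathcomp Require Import all_boot all_order all_algebra.
From mathcomp Require Import finmap complex sesquilinear spectral.
From mathcomp Require Import all_classical all_reals all_analysis.
From mathcomp Require Import ring lra.
From mathcomp Require monalg.
Import -(notations) monalg.

(** Write L for the operator I - (D (x) I)(I (x) delta(T)), and L_x for the same
    operator with delta(x) in place of delta(T). The realization says that
    L_x u(x) = C (x) I for x in Gdelta, and, being isometric, it makes D a
    contraction. The theorem compares the solutions u(x) for x near T with a
    possible solution of L v = C (x) I at T itself.

    If T is a B-point, the model identity at y = x,
      I - phi(x)^* phi(x) = u(x)^* (I (x) (I - delta(x)^* delta(x))) u(x)
                         >= (1 - |delta(x)|^2) u(x)^* u(x),
    shows that the quotients in the definition of a B-point bound |u(Z_j)|^2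
    (model_bound). Since delta(Z_j) tends to delta(T), the bounded vectors u(Z_j)
    satisfy L u(Z_j) -> C (x) I. In a Hilbert space this forces C (x) I to lie in
    the range of L (approx_solution): least-norm approximate solutions form a
    Cauchy sequence by the parallelogram identity.

    Conversely let L v = C (x) I and let H be an inward direction, say
    delta(T)^* nabla delta(T)[H] <= -c. As delta(T) is isometric, for Z = T + tH
      delta(Z)^* delta(Z) = I + 2t delta(T)^* nabla delta(T)[H] + O(t^2),
    so Z lies in Gdelta and 1 - |delta(Z)|^2 >= ct for small t > 0
    (inward_estimate). The difference y = u(Z) - v satisfies
      L_Z y = (D (x) I)(I (x) (delta(Z) - delta(T))) v,
    whence (1 - |delta(Z)|) |y| <= O(t) |v| and y stays bounded as t tends to 0.
    By the model identity |I - phi(Z)^* phi(Z)| <= |u(Z)|^2 O(t) (opnorm_defect),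
    so the B-point quotient is bounded along Z, and Bolzano-Weierstrass selects a
    sequence along which it converges.

    Inequalities between matrices are transported to E (x) C^J (x) C^n by
    diagonalization: a positive semidefinite M stays so after tensoring with I_E
    (psd_tens). *)

Import Order.TTheory GRing.Theory Num.Theory.
Import numFieldNormedType.Exports.

Set Implicit Arguments.
Unset Strict Implicit.
Unset Printing Implicit Defensive.

Local Open Scope classical_set_scope.
Local Open Scope ring_scope.
Local Open Scope sesquilinear_scope.

(** * Real-valued modulus *)

(** The norm of the complex numbers takes its values in R[i], while operator
    norms, infima and limits of quotients live in R. *)
Definition absR (R : realType) (z : R[i]) : R := complex.Re `|z|.

Lemma absRE (R : realType) (z : R[i]) : `|z| = (absR z)%:C%C.
Proof. by rewrite /absR RRe_real// normr_real. Qed.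

Lemma absR_ge0 (R : realType) (z : R[i]) : 0 <= absR z.
Proof. by rewrite -ler0c -absRE. Qed.

Lemma absRM (R : realType) (y z : R[i]) : absR (y * z) = absR y * absR z.
Proof. by apply: complexI; rewrite rmorphM/= -!absRE normrM. Qed.

Lemma absRD (R : realType) (y z : R[i]) : absR (y + z) <= absR y + absR z.
Proof. by rewrite -lecR rmorphD/= -!absRE ler_normD. Qed.

Lemma absR_conj (R : realType) (z : R[i]) : absR z^* = absR z.
Proof. by apply: complexI; rewrite -!absRE norm_conjC. Qed.

Lemma absR_ge0E (R : realType) (z : R[i]) : 0 <= z -> absR z = complex.Re z.
Proof. by move=> z0; rewrite /absR ger0_norm. Qed.

Lemma absR_real (R : realType) (x : R) : 0 <= x -> absR x%:C%C = x.
Proof. by move=> x0; rewrite absR_ge0E// ler0c. Qed.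

Lemma Re_le_absR (R : realType) (z : R[i]) : complex.Re z <= absR z.
Proof.
rewrite /absR normc_def/=; apply: le_trans (ler_norm _) _.
by rewrite -sqrtr_sqr ler_wsqrtr// lerDl sqr_ge0.
Qed.

Lemma absR_sum (R : realType) (I : finType) (F : I -> R[i]) :
  absR (\sum_i F i) <= \sum_i absR (F i).
Proof.
rewrite -lecR -absRE rmorph_sum/=.
by apply: le_trans (ler_norm_sum _ _ _) _; apply: ler_sum => i _; rewrite absRE.
Qed.

(** * The Hilbert space E (x) C^J (x) C^n *)

Section hilbert_tensor.
Variables (R : realType) (E : hilbertType R) (J n : nat).
Implicit Types (v w x y : hten E J n) (a : R[i]).

Lemma hten_dotDl v w x : hten_dot (v + w) x = hten_dot v x + hten_dot w x.
Proof.
rewrite /hten_dot -big_split/=; apply: eq_bigr => p _.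
by rewrite ffunE linearDl.
Qed.

Lemma hten_dotZl a v w : hten_dot (a *: v) w = a * hten_dot v w.
Proof.
rewrite /hten_dot mulr_sumr; apply: eq_bigr => p _.
by rewrite ffunE linearZl_LR.
Qed.

Lemma hten_dotC v w : hten_dot v w = (hten_dot w v)^*.
Proof.
rewrite /hten_dot rmorph_sum/=; apply: eq_bigr => p _.
by rewrite hermC/= expr0 mul1r.
Qed.

Lemma hten_dotDr v w x : hten_dot x (v + w) = hten_dot x v + hten_dot x w.
Proof. by rewrite hten_dotC hten_dotDl rmorphD/= -!hten_dotC. Qed.

Lemma hten_dotZr a v w : hten_dot w (a *: v) = a^* * hten_dot w v.
Proof. by rewrite hten_dotC hten_dotZl rmorphM/= -hten_dotC. Qed.

Lemma hten_dotNl v w : hten_dot (- v) w = - hten_dot v w.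
Proof. by rewrite -scaleN1r hten_dotZl mulN1r. Qed.

Lemma hten_dotNr v w : hten_dot w (- v) = - hten_dot w v.
Proof. by rewrite hten_dotC hten_dotNl rmorphN/= -hten_dotC. Qed.

Lemma hten_dot_ge0 v : 0 <= hten_dot v v.
Proof. by apply: sumr_ge0 => p _; rewrite -hdot_norm exprn_ge0. Qed.

Definition hten_sqnorm v : R := complex.Re (hten_dot v v).

Lemma hten_sqnormE v : hten_dot v v = (hten_sqnorm v)%:C%C.
Proof. by rewrite /hten_sqnorm RRe_real// ger0_real// hten_dot_ge0. Qed.

Lemma hten_sqnorm_ge0 v : 0 <= hten_sqnorm v.
Proof. by rewrite -ler0c -hten_sqnormE hten_dot_ge0. Qed.

Lemma hten_sqnorm_sum v : (hten_sqnorm v)%:C%C = \sum_p `|v p| ^+ 2.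
Proof. by rewrite -hten_sqnormE; apply: eq_bigr => p _; rewrite hdot_norm. Qed.

Lemma hten_sqnorm_coord v p : `|v p| ^+ 2 <= (hten_sqnorm v)%:C%C.
Proof.
by rewrite hten_sqnorm_sum (bigD1 p)//= lerDl sumr_ge0// => q _; rewrite exprn_ge0.
Qed.

Lemma hten_sqnorm_eq0 v : hten_sqnorm v = 0 -> v = 0.
Proof.
move=> v0; apply/ffunP => p; rewrite ffunE; apply/eqP.
have := hten_sqnorm_coord v p; rewrite v0 => h.
by rewrite -normr_eq0 -sqrf_eq0 eq_le h exprn_ge0.
Qed.

Lemma hten_sqnormZ a v : hten_sqnorm (a *: v) = absR a ^+ 2 * hten_sqnorm v.
Proof.
apply: complexI; rewrite -hten_sqnormE hten_dotZl hten_dotZr mulrA -normCK.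
by rewrite rmorphM rmorphXn/= -absRE hten_sqnormE.
Qed.

Lemma hten_sqnorm0 : hten_sqnorm 0 = 0.
Proof.
apply: complexI.
by rewrite -hten_sqnormE -[X in hten_dot X _](scale0r 0) hten_dotZl mul0r.
Qed.

Lemma hten_sqnormN v : hten_sqnorm (- v) = hten_sqnorm v.
Proof. by rewrite -scaleN1r hten_sqnormZ /absR normrN normr1 expr1n mul1r. Qed.

Lemma hten_sqnormD v w :
  hten_sqnorm (v + w) =
  hten_sqnorm v + hten_sqnorm w + 2 * complex.Re (hten_dot v w).
Proof.
rewrite /hten_sqnorm hten_dotDl !hten_dotDr [hten_dot w v]hten_dotC.
case: (hten_dot v w) => a b; rewrite !raddfD/=; ring.
Qed.

Lemma hten_parallelogram v w :
  hten_sqnorm (v - w) = 2 * hten_sqnorm v + 2 * hten_sqnorm w - hten_sqnorm (v + w).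
Proof. rewrite !hten_sqnormD hten_sqnormN hten_dotNr raddfN/=; ring. Qed.

(** Expand the square norm of |w|^2 v - <v, w> w, which is nonnegative. *)
Lemma hten_dot_sqr_le v w :
  absR (hten_dot v w) ^+ 2 <= hten_sqnorm v * hten_sqnorm w.
Proof.
have [w0|wn0] := eqVneq (hten_sqnorm w) 0.
  rewrite (hten_sqnorm_eq0 w0) -(scale0r 0) hten_dotZr conjC0 mul0r.
  by rewrite /absR normr0/= expr0n/= scale0r hten_sqnorm0 mulr0.
have w_gt0 : 0 < hten_sqnorm w by rewrite lt_def wn0 hten_sqnorm_ge0.
set c := hten_dot v w.
have := hten_sqnorm_ge0 ((hten_sqnorm w)%:C%C *: v - c *: w).
suff -> : hten_sqnorm ((hten_sqnorm w)%:C%C *: v - c *: w) =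
          hten_sqnorm w * (hten_sqnorm v * hten_sqnorm w - absR c ^+ 2).
  by rewrite pmulr_rge0// subr_ge0.
rewrite hten_sqnormD hten_sqnormN !hten_sqnormZ.
rewrite hten_dotNr hten_dotZl hten_dotZr -/c.
rewrite absR_real ?hten_sqnorm_ge0//.
have -> : (hten_sqnorm w)%:C%C * (c^* * c) = (hten_sqnorm w * absR c ^+ 2)%:C%C.
  by rewrite mulrC rmorphM rmorphXn/= -absRE normCK; ring.
rewrite raddfN/=; ring.
Qed.

Definition hten_norm v : R := Num.sqrt (hten_sqnorm v).

Lemma hten_norm_ge0 v : 0 <= hten_norm v. Proof. exact: sqrtr_ge0. Qed.

Lemma sqr_hten_norm v : hten_norm v ^+ 2 = hten_sqnorm v.
Proof. by rewrite sqr_sqrtr ?hten_sqnorm_ge0. Qed.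

Lemma hten_norm_eq0 v : hten_norm v = 0 -> v = 0.
Proof. by move=> v0; apply: hten_sqnorm_eq0; rewrite -sqr_hten_norm v0 expr0n. Qed.

Lemma hten_normZ a v : hten_norm (a *: v) = absR a * hten_norm v.
Proof.
rewrite /hten_norm hten_sqnormZ sqrtrM ?sqr_ge0//.
by rewrite sqrtr_sqr ger0_norm// absR_ge0.
Qed.

Lemma hten_normN v : hten_norm (- v) = hten_norm v.
Proof. by rewrite /hten_norm hten_sqnormN. Qed.

Lemma hten_norm_leE v (r : R) : 0 <= r ->
  (hten_norm v <= r) = (hten_sqnorm v <= r ^+ 2).
Proof. by move=> r0; rewrite -sqr_hten_norm ler_pXn2r// nnegrE ?hten_norm_ge0. Qed.

Lemma hten_cauchy_schwarz v w : absR (hten_dot v w) <= hten_norm v * hten_norm w.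
Proof.
rewrite -(ler_pXn2r (ltn0Sn 1)) ?nnegrE ?absR_ge0 ?mulr_ge0 ?hten_norm_ge0//.
by rewrite exprMn !sqr_hten_norm hten_dot_sqr_le.
Qed.

Lemma hten_normD v w : hten_norm (v + w) <= hten_norm v + hten_norm w.
Proof.
rewrite hten_norm_leE ?addr_ge0 ?hten_norm_ge0// hten_sqnormD.
rewrite sqrrD !sqr_hten_norm [leRHS]addrAC lerD2l.
rewrite -[leRHS]mulr_natl ler_wpM2l//.
exact: le_trans (Re_le_absR _) (hten_cauchy_schwarz _ _).
Qed.

Lemma hten_normB v w : hten_norm (v - w) <= hten_norm v + hten_norm w.
Proof. by rewrite (le_trans (hten_normD _ _))// hten_normN. Qed.

Lemma hten_norm_coord v p : `|v p| <= (hten_norm v)%:C%C.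
Proof.
rewrite -(ler_pXn2r (ltn0Sn 1)) ?nnegrE ?ler0c ?hten_norm_ge0//.
by rewrite -rmorphXn/= sqr_hten_norm hten_sqnorm_coord.
Qed.

End hilbert_tensor.

(** * Norms and quadratic forms of complex matrices *)

Section matrix_norms.
Variable R : realType.

Definition qform m (M : 'M[R[i]]_m) (v : 'cV[R[i]]_m) : R[i] :=
  (v ^t* *m M *m v) 0 0.

(** A submultiplicative norm that is computed from the entries and dominates
    opnorm; all error terms are measured by it. *)
Definition mxnorm1 p m (M : 'M[R[i]]_(p, m)) : R := \sum_i \sum_j absR (M i j).

Lemma mxnorm1_ge0 p m (M : 'M[R[i]]_(p, m)) : 0 <= mxnorm1 M.
Proof. by do 2![apply: sumr_ge0 => ? _]; exact: absR_ge0. Qed.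

Lemma mxnorm1D p m (M N : 'M[R[i]]_(p, m)) :
  mxnorm1 (M + N) <= mxnorm1 M + mxnorm1 N.
Proof.
rewrite /mxnorm1 -big_split/=; apply: ler_sum => i _.
by rewrite -big_split/=; apply: ler_sum => j _; rewrite mxE absRD.
Qed.

Lemma mxnorm1Z p m a (M : 'M[R[i]]_(p, m)) : mxnorm1 (a *: M) = absR a * mxnorm1 M.
Proof.
rewrite /mxnorm1 mulr_sumr; apply: eq_bigr => i _.
by rewrite mulr_sumr; apply: eq_bigr => j _; rewrite mxE absRM.
Qed.

Lemma mxnorm10 m p : mxnorm1 (0 : 'M[R[i]]_(m, p)) = 0.
Proof. by rewrite -(scale0r 0) mxnorm1Z /absR normr0 mul0r. Qed.

Lemma mxnorm1BC m p (M N : 'M[R[i]]_(m, p)) : mxnorm1 (M - N) = mxnorm1 (N - M).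
Proof. by rewrite -opprB -scaleN1r mxnorm1Z /absR normrN normr1 mul1r. Qed.

Lemma mxnorm1_entry m p (M : 'M[R[i]]_(m, p)) i j : absR (M i j) <= mxnorm1 M.
Proof.
rewrite /mxnorm1 (bigD1 i)//= (bigD1 j)//= -addrA lerDl.
by rewrite addr_ge0// ?sumr_ge0// => *; rewrite ?sumr_ge0// => *; exact: absR_ge0.
Qed.

Lemma mxnorm1_adj p m (M : 'M[R[i]]_(p, m)) : mxnorm1 (M ^t*) = mxnorm1 M.
Proof.
rewrite /mxnorm1 exchange_big/=; apply: eq_bigr => i _; apply: eq_bigr => j _.
by rewrite !mxE absR_conj.
Qed.

Lemma mxnorm1M p m q (M : 'M[R[i]]_(p, m)) (N : 'M[R[i]]_(m, q)) :
  mxnorm1 (M *m N) <= mxnorm1 M * mxnorm1 N.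
Proof.
rewrite /mxnorm1 mulr_suml; apply: ler_sum => i _.
apply: (@le_trans _ _ (\sum_k \sum_j absR (M i j) * absR (N j k))).
  apply: ler_sum => k _; rewrite mxE; apply: (le_trans (absR_sum _)).
  by apply: ler_sum => j _; rewrite absRM.
rewrite exchange_big/= mulr_suml; apply: ler_sum => j _.
rewrite -mulr_sumr ler_wpM2l ?absR_ge0//.
by rewrite (bigD1 j)//= lerDl; do 2![apply: sumr_ge0 => ? _]; exact: absR_ge0.
Qed.

Lemma vnorm_ge0 m (v : 'cV[R[i]]_m) : 0 <= vnorm v.
Proof. exact: sqrtr_ge0. Qed.

Lemma vnorm_sum m (v : 'cV[R[i]]_m) : vnorm v ^+ 2 = \sum_i absR (v i 0) ^+ 2.
Proof. by rewrite sqr_sqrtr// sumr_ge0// => i _; rewrite sqr_ge0. Qed.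

Lemma vnormE m (v : 'cV[R[i]]_m) : (vnorm v ^+ 2)%:C%C = (v ^t* *m v) 0 0.
Proof.
rewrite vnorm_sum rmorph_sum mxE; apply: eq_bigr => i _.
by rewrite rmorphXn/= -absRE normCK !mxE mulrC.
Qed.

Lemma vnormZ m a (v : 'cV[R[i]]_m) : vnorm (a *: v) = absR a * vnorm v.
Proof.
apply/eqP; rewrite -(eqrXn2 (ltn0Sn 1)) ?mulr_ge0 ?absR_ge0 ?vnorm_ge0//.
rewrite exprMn !vnorm_sum mulr_sumr; apply/eqP/eq_bigr => i _.
by rewrite mxE absRM exprMn.
Qed.

Lemma vnorm_coord m (v : 'cV[R[i]]_m) k : absR (v k 0) <= vnorm v.
Proof.
rewrite -(ler_pXn2r (ltn0Sn 1)) ?nnegrE ?absR_ge0 ?vnorm_ge0//.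
by rewrite vnorm_sum (bigD1 k)//= lerDl sumr_ge0// => i _; rewrite sqr_ge0.
Qed.

Lemma vnorm_eq0 m (v : 'cV[R[i]]_m) : vnorm v = 0 -> v = 0.
Proof.
move=> v0; apply/colP => k; rewrite mxE; apply/eqP; rewrite -normr_eq0 absRE.
have := vnorm_coord v k; rewrite v0 => h.
by rewrite (_ : absR _ = 0)//; apply/eqP; rewrite eq_le h absR_ge0.
Qed.

Lemma vnorm0 m : vnorm (0 : 'cV[R[i]]_m) = 0.
Proof. by rewrite -(scale0r 0) vnormZ /absR normr0 mul0r. Qed.

Lemma vnorm_delta m k : vnorm (delta_mx k 0 : 'cV[R[i]]_m) = 1.
Proof.
apply/eqP; rewrite -(eqrXn2 (ltn0Sn 1)) ?vnorm_ge0// expr1n vnorm_sum.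
rewrite (bigD1 k)//= mxE !eqxx big1 ?addr0 => [|i /negbTE ik].
  by rewrite /absR normr1 expr1n.
by rewrite mxE ik /absR normr0/= expr0n.
Qed.

Lemma sum_sqr_le (I : finType) (r : I -> R) : (forall i, 0 <= r i) ->
  \sum_i r i ^+ 2 <= (\sum_i r i) ^+ 2.
Proof.
move=> r0; rewrite expr2 mulr_suml; apply: ler_sum => i _.
rewrite expr2 ler_wpM2l//.
by rewrite (bigD1 i)//= lerDl sumr_ge0.
Qed.

Lemma vnorm_le_mxnorm1 p m (M : 'M[R[i]]_(p, m)) v :
  vnorm (M *m v) <= mxnorm1 M * vnorm v.
Proof.
rewrite -(ler_pXn2r (ltn0Sn 1)) ?nnegrE ?mulr_ge0 ?mxnorm1_ge0 ?vnorm_ge0//.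
rewrite vnorm_sum exprMn.
apply: (@le_trans _ _ (\sum_i (\sum_j absR (M i j)) ^+ 2 * vnorm v ^+ 2)).
  apply: ler_sum => i _; rewrite -exprMn.
  rewrite ler_pXn2r ?nnegrE ?mulr_ge0 ?sumr_ge0 ?absR_ge0 ?vnorm_ge0//;
    last by move=> *; exact: absR_ge0.
  rewrite mxE mulr_suml; apply: (le_trans (absR_sum _)); apply: ler_sum => j _.
  by rewrite absRM ler_wpM2l ?absR_ge0 ?vnorm_coord.
rewrite -mulr_suml ler_wpM2r ?sqr_ge0//; apply: sum_sqr_le => i.
by apply: sumr_ge0 => *; exact: absR_ge0.
Qed.

Section opnorm.
Variables (p m : nat) (M : 'M[R[i]]_(p, m)).

Let opset := [set vnorm (M *m v) | v in [set v : 'cV[R[i]]_m | vnorm v <= 1]].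

Let opset_sup : has_sup opset.
Proof.
split; first by exists (vnorm (M *m 0)), 0 => //=; rewrite vnorm0.
exists (mxnorm1 M) => _ [v /= v1 <-]; apply: (le_trans (vnorm_le_mxnorm1 _ _)).
by rewrite ler_piMr ?mxnorm1_ge0.
Qed.

Lemma opnorm_ge0 : 0 <= opnorm M.
Proof.
apply: (@le_trans _ _ (vnorm (M *m 0))); first exact: vnorm_ge0.
by apply: sup_upper_bound => //; exists 0 => //=; rewrite vnorm0.
Qed.

Lemma opnorm_le (c : R) : (forall v, vnorm (M *m v) <= c * vnorm v) -> 0 <= c ->
  opnorm M <= c.
Proof.
move=> Mc c0; apply: sup_le_ub; first by case: opset_sup.
by move=> _ [v /= v1 <-]; apply: (le_trans (Mc _)); rewrite ler_piMr.
Qed.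

Lemma vnorm_opnorm v : vnorm (M *m v) <= opnorm M * vnorm v.
Proof.
have [v0|vn0] := eqVneq (vnorm v) 0.
  by rewrite (vnorm_eq0 v0) mulmx0 !vnorm0 mulr0.
have v_gt0 : 0 < vnorm v by rewrite lt_def vn0 vnorm_ge0.
rewrite -ler_pdivrMr// mulrC.
have a0 : 0 <= (vnorm v)^-1 by rewrite invr_ge0 ltW.
have -> : (vnorm v)^-1 * vnorm (M *m v) = vnorm (M *m (((vnorm v)^-1)%:C%C *: v)).
  by rewrite -scalemxAr vnormZ absR_real.
apply: sup_upper_bound => //; exists (((vnorm v)^-1)%:C%C *: v) => //=.
by rewrite vnormZ absR_real// mulVf.
Qed.

Lemma opnorm_le_mxnorm1 : opnorm M <= mxnorm1 M.
Proof. apply: opnorm_le (mxnorm1_ge0 _); exact: vnorm_le_mxnorm1. Qed.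

Lemma opnorm_entry i j : absR (M i j) <= opnorm M.
Proof.
have := vnorm_opnorm (delta_mx j 0); rewrite vnorm_delta mulr1.
apply: le_trans; apply: le_trans (vnorm_coord _ i).
by rewrite -colE mxE.
Qed.

End opnorm.

Lemma adjmxM p m q (M : 'M[R[i]]_(p, m)) (N : 'M[R[i]]_(m, q)) :
  (M *m N) ^t* = N ^t* *m M ^t*.
Proof. by rewrite trmx_mul map_mxM. Qed.

Lemma adjmx1 m : (1%:M : 'M[R[i]]_m) ^t* = 1%:M.
Proof. by rewrite trmx1 map_mx1. Qed.

Lemma vnormM p m (M : 'M[R[i]]_(p, m)) v :
  (vnorm (M *m v) ^+ 2)%:C%C = qform (M ^t* *m M) v.
Proof. by rewrite vnormE adjmxM /qform !mulmxA. Qed.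

Lemma qformD m (M N : 'M[R[i]]_m) v : qform (M + N) v = qform M v + qform N v.
Proof. by rewrite /qform mulmxDr mulmxDl mxE. Qed.

Lemma qformZ m a (M : 'M[R[i]]_m) v : qform (a *: M) v = a * qform M v.
Proof. by rewrite /qform -scalemxAr -scalemxAl mxE. Qed.

Lemma qform1 m v : qform (1%:M : 'M[R[i]]_m) v = (vnorm v ^+ 2)%:C%C.
Proof. by rewrite /qform mulmx1 vnormE. Qed.

Lemma absR_qform m (M : 'M[R[i]]_m) v :
  absR (qform M v) <= mxnorm1 M * vnorm v ^+ 2.
Proof.
rewrite /qform mxE; apply: (le_trans (absR_sum _)).
rewrite /mxnorm1 exchange_big mulr_suml /=; apply: ler_sum => j _.
rewrite mxE absRM !mulr_suml.
apply: (@le_trans _ _ ((\sum_i absR (M i j) * vnorm v) * vnorm v)).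
  apply: ler_pM; rewrite ?absR_ge0 ?vnorm_coord//.
  apply: (le_trans (absR_sum _)); apply: ler_sum => i _.
  by rewrite absRM mulrC ler_wpM2l ?absR_ge0// !mxE absR_conj vnorm_coord.
by rewrite mulr_suml; apply: ler_sum => i _; rewrite -mulrA -expr2.
Qed.

Lemma qform_congr m p (N : 'M[R[i]]_p) (P : 'M[R[i]]_(p, m)) v :
  qform (P ^t* *m N *m P) v = qform N (P *m v).
Proof. by rewrite /qform adjmxM !mulmxA. Qed.

Lemma qform_diag m (d : 'rV[R[i]]_m) v :
  qform (diag_mx d) v = \sum_k d 0 k * `|v k 0| ^+ 2.
Proof.
rewrite /qform mxE; apply: eq_bigr => k _.
by rewrite mul_mx_diag !mxE normCK; ring.
Qed.

(** Every eigenvalue is a value of the quadratic form at a nonzero vector, so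
    that sign conditions on the form pass to the eigenvalues. *)
Lemma herm_spectral m (M : 'M[R[i]]_m) : M ^t* = M ->
  exists (P : 'M[R[i]]_m) (d : 'rV[R[i]]_m),
    [/\ P ^t* *m P = 1%:M, M = P ^t* *m diag_mx d *m P &
        forall k, exists v, v != 0 /\ qform M v = d 0 k].
Proof.
move=> Mh; have /hermitian_normalmx/orthomx_spectralP ME : M \is hermsymmx.
  by apply/is_hermitianmxP; rewrite expr0 scale1r Mh.
have Pu := spectral_unitarymx M; move: ME; rewrite invmx_unitary//.
move: (spectralmx M) (spectral_diag M) Pu => P d Pu ME.
have PP : P *m P ^t* = 1%:M by apply/eqP; move: Pu; rewrite qualifE.
exists P, d; split => //; first exact: mulmx1C.
move=> k; exists (P ^t* *m delta_mx k 0); split.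
  apply: contraTneq isT => /(congr1 (mulmx P)).
  rewrite mulmxA PP mul1mx mulmx0 => /matrixP/(_ k 0)/eqP.
  by rewrite !mxE !eqxx oner_eq0.
rewrite ME qform_congr mulmxA PP mul1mx qform_diag (bigD1 k)//= mxE !eqxx.
rewrite big1 ?addr0 => [|i /negbTE ik]; first by rewrite normr1 expr1n mulr1.
by rewrite mxE ik normr0 expr0n mulr0.
Qed.

Definition psdmx m (M : 'M[R[i]]_m) : Prop :=
  M ^t* = M /\ forall v, 0 <= qform M v.

Lemma psd_diag m (M : 'M[R[i]]_m) : psdmx M ->
  exists (P : 'M[R[i]]_m) (d : 'rV[R[i]]_m),
    M = P ^t* *m diag_mx d *m P /\ forall k, 0 <= d 0 k.
Proof.
move=> [/herm_spectral[P [d [_ ME ev]]] M0]; exists P, d; split=> // k.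
by have [v [_ <-]] := ev k.
Qed.

(** A negative definite form is uniformly negative because it has finitely many
    eigenvalues. *)
Lemma negdef_coercive m (M : 'M[R[i]]_m) : negdef M ->
  exists2 c : R, 0 < c & forall v, qform M v <= - (c * vnorm v ^+ 2)%:C%C.
Proof.
move=> [/herm_spectral[P [d [PP ME ev]]] Mn].
have dneg k : d 0 k < 0 by have [v [v0 <-]] := ev k; exact: Mn.
have dE k : d 0 k = (complex.Re (d 0 k))%:C%C.
  by rewrite RRe_real// ltr0_real.
(* The default value 1 is only reached in dimension 0 or when all eigenvalues
   are below -1. *)
exists (\big[Num.min/1]_k - complex.Re (d 0 k)).
  by apply: lt_bigmin => // k _; rewrite oppr_gt0 -ltcR -dE.
move=> v; rewrite ME qform_congr.
have -> : vnorm v = vnorm (P *m v).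
  apply/eqP; rewrite -(eqrXn2 (ltn0Sn 1)) ?vnorm_ge0//; apply/eqP/complexI.
  by rewrite vnormM PP qform1.
rewrite qform_diag vnorm_sum -rmorphN/= mulr_sumr -sumrN rmorph_sum/=.
apply: ler_sum => k _; rewrite dE absRE -rmorphXn -rmorphM/= lecR -mulNr.
by rewrite ler_wpM2r ?sqr_ge0// lerNr bigmin_le.
Qed.

End matrix_norms.

(** * The operators I (x) M and D (x) I *)

Section tensor_operators.
Variables (R : realType) (E : hilbertType R) (J n : nat).
Implicit Types (v w : hten E J n) (M N : 'M[R[i]]_(\sum_(i < J) n)).

(** Basis vectors of C^J (x) C^n are pairs for hten, but rows of a matrix of
    n x n blocks for deval; this matches the two indexings. *)
Definition ten_idx (p : 'I_J * 'I_n) : 'I_(\sum_(i < J) n) :=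
  tagnat.Rank (p_ := fun=> n) p.1 p.2.

Lemma ten_idx_bij : bijective ten_idx.
Proof.
apply: inj_card_bij; last first.
  by rewrite card_ord card_prod !card_ord sum_nat_const card_ord.
move=> [i k] [j l] /tagnat.rank_inj/= /eqP; rewrite -tag_eqE /tag_eq/=.
by move=> /andP[/eqP ij]; subst j; rewrite tagged_asE => /eqP ->.
Qed.

Lemma idE_tensE M v p :
  idE_tens M v p = \sum_q M (ten_idx p) (ten_idx q) *: v q.
Proof. by rewrite ffunE; apply: eq_bigr => q _; rewrite mxE. Qed.

Lemma idE_tensM M N v : idE_tens (M *m N) v = idE_tens M (idE_tens N v).
Proof.
apply/ffunP => p; rewrite !idE_tensE.
under [RHS]eq_bigr => r _ do rewrite (idE_tensE N v r) scaler_sumr.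
rewrite exchange_big; apply: eq_bigr => q _.
rewrite mxE (reindex ten_idx)/=; last exact: onW_bij ten_idx_bij.
by rewrite scaler_suml; apply: eq_bigr => r _; rewrite scalerA.
Qed.

Lemma idE_tensD M N v : idE_tens (M + N) v = idE_tens M v + idE_tens N v.
Proof.
apply/ffunP => p; rewrite [RHS]ffunE !idE_tensE -big_split/=.
by apply: eq_bigr => q _; rewrite mxE scalerDl.
Qed.

Lemma idE_tensZ a M v : idE_tens (a *: M) v = a *: idE_tens M v.
Proof.
apply/ffunP => p; rewrite [RHS]ffunE !idE_tensE scaler_sumr.
by apply: eq_bigr => q _; rewrite mxE scalerA.
Qed.

Lemma idE_tensN M v : idE_tens (- M) v = - idE_tens M v.
Proof. by rewrite -scaleN1r idE_tensZ scaleN1r. Qed.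

Lemma idE_tensB M N v : idE_tens (M - N) v = idE_tens M v - idE_tens N v.
Proof. by rewrite idE_tensD idE_tensN. Qed.

Lemma idE_tens1 v : idE_tens 1%:M v = v.
Proof.
apply/ffunP => p; rewrite idE_tensE (bigD1 p)//= mxE eqxx scale1r big1 ?addr0//.
move=> q qp; rewrite mxE (inj_eq (bij_inj ten_idx_bij)) eq_sym (negbTE qp).
by rewrite scale0r.
Qed.

Lemma idE_tens_linear M : linear (idE_tens (E := E) M).
Proof.
move=> a v w; apply/ffunP => p; rewrite !ffunE scaler_sumr -big_split/=.
by apply: eq_bigr => q _; rewrite !ffunE scalerDr !scalerA mulrC.
Qed.

HB.instance Definition _ M := GRing.isLinear.Build R[i] (hten E J n) (hten E J n)
  _ (idE_tens (E := E) M) (idE_tens_linear M).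

Lemma idE_tens_adj M v w :
  hten_dot (idE_tens M v) w = hten_dot v (idE_tens (M ^t*) w).
Proof.
rewrite /hten_dot.
under eq_bigr => p _.
  rewrite idE_tensE linear_sumlz/=; under eq_bigr => q _ do rewrite linearZl_LR/=.
  over.
rewrite exchange_big; apply: eq_bigr => q _.
rewrite idE_tensE linear_sumr/=; apply: eq_bigr => p _.
by rewrite linearZr_LR/= !mxE conjCK.
Qed.

Lemma idE_tens_diag (d : 'rV[R[i]]_(\sum_(i < J) n)) v p :
  idE_tens (diag_mx d) v p = d 0 (ten_idx p) *: v p.
Proof.
rewrite idE_tensE (bigD1 p)//= [X in _ + X]big1 => [|q qp].
  by rewrite addr0 mxE eqxx.
rewrite mxE (inj_eq (bij_inj ten_idx_bij)) eq_sym (negbTE qp) mulr0n.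
by rewrite scale0r.
Qed.

(** If M = P^* diag(d) P with d nonnegative, then the form of I (x) M at v is the
    sum of the d_p |w_p|^2 for w = (I (x) P) v. *)
Lemma psd_tens M v : psdmx M -> 0 <= hten_dot (idE_tens M v) v.
Proof.
move=> /psd_diag[P [d [-> d0]]]; rewrite !idE_tensM idE_tens_adj trmxCK.
set w := idE_tens P v; apply: sumr_ge0 => p _.
by rewrite idE_tens_diag linearZl_LR/= mulr_ge0 ?d0// -hdot_norm exprn_ge0.
Qed.

(** Tensoring with I_E does not increase the norm: psd_tens applies to
    |M|^2 I - M^* M. *)
Lemma hten_norm_idE_tens M v : hten_norm (idE_tens M v) <= opnorm M * hten_norm v.
Proof.
rewrite hten_norm_leE ?mulr_ge0 ?opnorm_ge0 ?hten_norm_ge0//.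
rewrite exprMn sqr_hten_norm -subr_ge0 -ler0c.
set N := ((opnorm M ^+ 2)%:C%C)%:M - M ^t* *m M.
suff /(psd_tens v) : psdmx N.
  rewrite idE_tensB hten_dotDl hten_dotNl -scalemx1 idE_tensZ idE_tens1.
  rewrite hten_dotZl idE_tensM idE_tens_adj trmxCK !hten_sqnormE.
  by rewrite -rmorphM -rmorphB.
split=> [|x].
  rewrite linearB/= map_mxB -/(_ ^t*) adjmxM trmxCK tr_scalar_mx map_scalar_mx/=.
  by congr (_%:M - _); exact: conjc_real.
rewrite /N -scalemx1 qformD qformZ qform1 -scaleN1r qformZ -vnormM mulN1r.
rewrite -rmorphM -rmorphB/= ler0c subr_ge0 -exprMn.
by rewrite ler_pXn2r ?nnegrE ?mulr_ge0 ?vnorm_ge0 ?opnorm_ge0// vnorm_opnorm.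
Qed.

Lemma hslice_linear (k : 'I_n) :
  linear (fun v : hten E J n => hslice v k : hvec E J).
Proof. by move=> a v w; apply/ffunP => j; rewrite !ffunE. Qed.

Lemma D_tens_linear (D : {linear hvec E J -> hvec E J}) :
  linear (D_tens D : hten E J n -> hten E J n).
Proof.
by move=> a v w; apply/ffunP => p; rewrite !ffunE hslice_linear linearP !ffunE.
Qed.

HB.instance Definition _ D := GRing.isLinear.Build R[i] (hten E J n) (hten E J n)
  _ (D_tens D : hten E J n -> hten E J n) (D_tens_linear D).

(** D (x) I acts separately on the n slices of v. *)
Lemma hten_norm_D_tens (D : {linear hvec E J -> hvec E J}) v :
  (forall x : hvec E J, hvec_sqnorm (D x) <= hvec_sqnorm x) ->
  hten_norm (D_tens D v) <= hten_norm v.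
Proof.
move=> Dle.
rewrite hten_norm_leE ?hten_norm_ge0// sqr_hten_norm -lecR !hten_sqnorm_sum.
have slices (w : hten E J n) :
    \sum_p `|w p| ^+ 2 = \sum_k hvec_sqnorm (hslice w k).
  transitivity (\sum_p `|w (p.1, p.2)| ^+ 2); first by apply: eq_bigr => -[].
  rewrite -(pair_bigA _ (fun j k => `|w (j, k)| ^+ 2)) exchange_big/=.
  by apply: eq_bigr => k _; apply: eq_bigr => j _; rewrite ffunE.
rewrite !slices; apply: ler_sum => k _; apply: le_trans (Dle _).
rewrite le_eqVlt; apply/orP; left; apply/eqP.
by congr hvec_sqnorm; apply/ffunP => j; rewrite !ffunE.
Qed.

End tensor_operators.

(** * Non-commutative polynomials along a line *)

Section nc_polynomials.
Variables (R : realType) (d : nat).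

Definition evalmx m p (F : 'M[{poly R[i]}]_(m, p)) (t : R[i]) : 'M[R[i]]_(m, p) :=
  map_mx (horner_eval t) F.

(** Evaluation at t is a ring morphism from matrices of polynomials to matrices,
    so the matrix of polynomials in t is obtained by evaluating q at the matrices
    T r + 'X H r. *)
Lemma nceval_line n (q : ncpoly R d) (T H : mtuple R d n) :
  exists F, forall t : R[i],
    nceval q ((fun r => T r + t *: H r) : mtuple R d n) = evalmx F t.
Proof.
pose G r : 'M[{poly R[i]}]_n := map_mx polyC (T r) + 'X *: map_mx polyC (H r).
exists (\sum_(w <- msupp q)
  (mcoeff w q)%:P *: \prod_(i <- monalg.fmonom_val w) G i) => t.
rewrite /nceval /evalmx raddf_sum/=; apply: eq_bigr => w _.
rewrite map_mxZ/= [X in _ = X *: _]hornerC; congr (_ *: _).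
elim/big_rec2: _ => [|r X Y _ ->]; first exact/esym/map_mx1.
rewrite -!mulmxE map_mxM; congr (_ *m _).
apply/matrixP => i j.
by rewrite !mxE/= /horner_eval hornerD hornerM hornerX !hornerC.
Qed.

Lemma deval_line J n (delta : 'M[ncpoly R d]_J) (T H : mtuple R d n) :
  exists F, forall t : R[i],
    deval delta ((fun r => T r + t *: H r) : mtuple R d n) = evalmx F t.
Proof.
pose F i j := projT1 (cid (nceval_line (delta i j) T H)).
have FE i j := projT2 (cid (nceval_line (delta i j) T H)).
exists (\mxblock_(i, j) F i j) => t; apply/mxblockP => i j.
rewrite mxblockK FE -/(F i j) /submxblock /evalmx -map_mxsub.
by congr map_mx; rewrite -[LHS](mxblockK F).
Qed.

(** On the unit disc the sum of the moduli of the coefficients is a bound. *)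
Lemma horner_bound (q : {poly R[i]}) :
  exists2 K : R, 0 <= K & forall t, `|t| <= 1 -> absR q.[t] <= K.
Proof.
exists (\sum_(k < size q) absR q`_k) => [|t t1].
  by apply: sumr_ge0 => k _; exact: absR_ge0.
rewrite horner_coef; apply: (le_trans (absR_sum _)); apply: ler_sum => k _.
rewrite absRM ler_piMr ?absR_ge0//.
by rewrite -lecR -absRE normrX exprn_ile1.
Qed.

Lemma evalmx_bound m p (F : 'M[{poly R[i]}]_(m, p)) :
  exists2 K : R, 0 <= K & forall t, `|t| <= 1 -> mxnorm1 (evalmx F t) <= K.
Proof.
pose K i j := projT1 (cid2 (horner_bound (F i j))).
have K0 i j : 0 <= K i j by rewrite /K; case: cid2.
have KE i j : forall t, `|t| <= 1 -> absR (F i j).[t] <= K i j.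
  by rewrite /K; case: cid2.
exists (\sum_i \sum_j K i j) => [|t t1]; first by do 2![apply: sumr_ge0 => ? _].
by do 2![apply: ler_sum => ? _]; rewrite mxE; exact: KE.
Qed.

(** Second order expansion along a line, with a remainder that is uniformly
    bounded for |t| <= 1: Q is, entry by entry, the quotient by t^2 of a
    polynomial in t. *)
Lemma deval_taylor J n (delta : 'M[ncpoly R d]_J) (T H : mtuple R d n) :
  exists N (K : R), 0 <= K /\ forall t : R[i], `|t| <= 1 -> exists Q,
    deval delta ((fun r => T r + t *: H r) : mtuple R d n) =
      deval delta T + t *: N + t ^+ 2 *: Q /\ mxnorm1 Q <= K.
Proof.
have [F FE] := deval_line delta T H.
have [K K0 KE] := evalmx_bound (map_mx (drop_poly 2) F).
exists (map_mx (fun q : {poly R[i]} => q`_1) F), K; split=> // t t1.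
exists (evalmx (map_mx (drop_poly 2) F) t); split; last exact: KE.
have -> : deval delta T = evalmx F 0.
  by rewrite -FE; congr deval; apply/funext => r; rewrite scale0r addr0.
rewrite FE; apply/matrixP => i j; rewrite !mxE /horner_eval.
move: (F i j) => q; rewrite horner_coef0.
rewrite -{1}(poly_take_drop 2 q) hornerD hornerM hornerXn.
congr (_ + _); last by rewrite mulrC.
rewrite (@horner_coef_wide _ 2) ?size_take_poly// !big_ord_recl big_ord0/=.
by rewrite !coef_take_poly/= expr0 mulr1 addr0 mulrC.
Qed.

End nc_polynomials.

(** * Limits of matrices *)

Section limits.
Variables (R : realType) (d J : nat).

(** Convergence expressed by one real sequence, so that products are handled by
    submultiplicativity; mxcvgE relates it to the topology. *)
Definition mxcvg m p (X : nat -> 'M[R[i]]_(m, p)) (M : 'M[R[i]]_(m, p)) : Prop :=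
  (fun k => mxnorm1 (X k - M)) @ \oo --> (0 : R).

Lemma mx_nbhs_entry (T : topologicalType) m p (N : 'M[T]_(m, p)) i j (P : set T) :
  nbhs (N i j) P -> nbhs N [set M : 'M[T]_(m, p) | P (M i j)].
Proof.
move=> NP.
exists (fun k l => [set z | k = i -> l = j -> P z]) => [k l|M]; last exact.
have [->|ki] := eqVneq k i; last first.
  by apply: filterS filterT => z _ /= ki'; rewrite ki' eqxx in ki.
have [->|lj] := eqVneq l j; last first.
  by apply: filterS filterT => z _ /= _ lj'; rewrite lj' eqxx in lj.
by apply: filterS NP => z Pz _ _.
Qed.

(** Needed for the value of lim to be determined by convergence. *)
Lemma mx_hausdorff (T : topologicalType) m p :
  hausdorff_space T -> hausdorff_space 'M[T]_(m, p).
Proof.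
move=> hT M N MN; apply/matrixP => i j; apply: hT => A B MA NB.
by have [X [XA XB]] := MN _ _ (mx_nbhs_entry MA) (mx_nbhs_entry NB); exists (X i j).
Qed.

(** Neighbourhoods of a matrix are given entry by entry; as there are finitely
    many entries, convergence can be tested on the sum of their moduli. *)
Lemma cvg_mxP (T : Type) (F : set_system T) (FF : Filter F) m p
    (g : T -> 'M[R[i]]_(m, p)) (N : 'M[R[i]]_(m, p)) :
  g @ F --> N <->
  forall e : R, 0 < e -> \forall t \near F, mxnorm1 (N - g t) <= e.
Proof.
split=> [gN e e0|gN A [P NP PA]].
  pose c := e / ((m * p)%:R + 1).
  have c0 : 0 < c by rewrite divr_gt0// ltr_wpDl.
  have gc i j : \forall t \near F, absR (N i j - g t i j) <= c.
    have gij : (fun t => g t i j) @ F --> N i j.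
      by move=> A /mx_nbhs_entry; exact: gN.
    have cC : 0 < c%:C%C by rewrite ltcR.
    move/cvgrPdist_le : gij => /(_ _ cC); apply: filterS => t.
    by rewrite absRE lecR.
  have Fc : \forall t \near F, forall ij, absR (N ij.1 ij.2 - g t ij.1 ij.2) <= c.
    by apply: filter_forall => ij; exact: gc.
  apply: filterS Fc => t gt.
  apply: (@le_trans _ _ (\sum_(i < m) \sum_(j < p) c)).
    by apply: ler_sum => i _; apply: ler_sum => j _; rewrite !mxE (gt (i, j)).
  rewrite !sumr_const !card_ord -mulrnA -mulr_natr /c -mulrA ler_piMr ?ltW//.
  by rewrite mulrC ltr_pdivrMr ?ltr_wpDl// mul1r mulnC ltrDl.
have Fij ij : \forall t \near F, P ij.1 ij.2 (g t ij.1 ij.2).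
  have /nbhs_ballP[e /= e0 eP] := NP ij.1 ij.2.
  have eE : e = (complex.Re e)%:C%C by rewrite RRe_real// gtr0_real.
  have e1 : 0 < complex.Re e by rewrite -ltcR -eE.
  apply: filterS (gN _ (divr_gt0 e1 (ltr0n _ 2))) => t gt; apply: eP.
  rewrite -ball_normE/= eE absRE ltcR; apply: (@le_lt_trans _ _ (complex.Re e / 2)).
    by apply: le_trans gt; have := mxnorm1_entry (N - g t) ij.1 ij.2; rewrite !mxE.
  by rewrite ltr_pdivrMr// ltr_pMr ?ltr1n.
have Fall : \forall t \near F, forall ij, P ij.1 ij.2 (g t ij.1 ij.2).
  exact: filter_forall.
by apply: filterS Fall => t Pt; apply: PA => i j; exact: (Pt (i, j)).
Qed.

(** The difference quotient at t <> 0 is N + t Q, hence nabla is the linear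
    coefficient of the expansion of deval_taylor. *)
Lemma nabla_taylor (delta : 'M[ncpoly R d]_J) n (T H : mtuple R d n)
    N (K : R) : 0 <= K ->
  (forall t : R[i], `|t| <= 1 -> exists Q,
    deval delta ((fun r => T r + t *: H r) : mtuple R d n) =
      deval delta T + t *: N + t ^+ 2 *: Q /\ mxnorm1 Q <= K) ->
  nabla delta T H = N.
Proof.
move=> K0 tay; rewrite /nabla; apply: cvg_lim.
  by apply: mx_hausdorff; exact: norm_hausdorff.
apply/cvg_mxP => e e0.
(* For |t| < c the expansion applies and its error |t| K is at most e. *)
pose c := Num.min 1 (e / (K + 1)).
have c0 : 0 < c by rewrite lt_min ltr01 divr_gt0// ltr_wpDl.
have cC : 0 < c%:C%C by rewrite ltcR.
near=> t.
have tn0 : t != 0 by near: t; exact: nbhs_dnbhs_neq.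
have tc : `|t| < c%:C%C.
  near: t; apply: nbhs_dnbhs; have := nbhsx_ballx (0 : R[i]) _ cC.
  by apply: filterS => t; rewrite -ball_normE/= sub0r normrN.
move: tc; rewrite absRE ltcR lt_min => /andP[t1 te].
have [|Q [-> QK]] := tay t; first by rewrite absRE lecR ltW.
rewrite -[X in X - deval _ _]addrA [X in X - deval _ _]addrC addrK.
rewrite scalerDr !scalerA mulVf// scale1r.
rewrite opprD addrA subrr add0r -scaleN1r scalerA expr2 mulrA mulrA.
rewrite mulN1r mulNr mulVf// mulN1r mxnorm1Z.
rewrite (_ : absR (- t) = absR t); last by rewrite /absR normrN.
apply: (@le_trans _ _ (e / (K + 1) * K)).
  by apply: ler_pM; rewrite ?absR_ge0 ?mxnorm1_ge0// ltW.
rewrite mulrAC ler_pdivrMr ?ltr_wpDl// ler_wpM2l ?ltW//.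
by rewrite ltrDl.
Unshelve. all: by end_near. Qed.

Lemma mxcvg_le m p (X : nat -> 'M[R[i]]_(m, p)) M (r : nat -> R) :
  (forall k, mxnorm1 (X k - M) <= r k) -> r @ \oo --> 0 -> mxcvg X M.
Proof.
move=> Xr r0; apply: (@squeeze_cvgr _ _ _ _ (cst 0) r) => //; last exact: cvg_cst.
by apply: nearW => k; rewrite mxnorm1_ge0 Xr.
Qed.

Lemma mxcvg_cst m p (M : 'M[R[i]]_(m, p)) : mxcvg (fun=> M) M.
Proof.
apply: (@mxcvg_le _ _ _ _ (fun=> 0)) => [k|]; last exact: cvg_cst.
by rewrite subrr mxnorm10.
Qed.

Lemma mxcvgD m p (X Y : nat -> 'M[R[i]]_(m, p)) M N :
  mxcvg X M -> mxcvg Y N -> mxcvg (fun k => X k + Y k) (M + N).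
Proof.
move=> XM YN.
apply: (@mxcvg_le _ _ _ _ (fun k => mxnorm1 (X k - M) + mxnorm1 (Y k - N))).
  by move=> k; rewrite opprD addrACA mxnorm1D.
by rewrite -[0]addr0; apply: cvgD.
Qed.

Lemma mxcvgZ m p a (X : nat -> 'M[R[i]]_(m, p)) M :
  mxcvg X M -> mxcvg (fun k => a *: X k) (a *: M).
Proof.
move=> XM; apply: (@mxcvg_le _ _ _ _ (fun k => absR a * mxnorm1 (X k - M))).
  by move=> k; rewrite -scalerBr mxnorm1Z.
by rewrite -[0](mulr0 (absR a)); apply: cvgMr.
Qed.

Lemma mxcvgM m p q (X : nat -> 'M[R[i]]_(m, p)) (Y : nat -> 'M[R[i]]_(p, q)) M N :
  mxcvg X M -> mxcvg Y N -> mxcvg (fun k => X k *m Y k) (M *m N).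
Proof.
move=> XM YN.
apply: (@mxcvg_le _ _ _ _ (fun k => mxnorm1 (X k - M) * mxnorm1 (Y k - N)
    + mxnorm1 (X k - M) * mxnorm1 N + mxnorm1 M * mxnorm1 (Y k - N))).
  move=> k.
  have -> : X k *m Y k - M *m N = (X k - M) *m (Y k - N) + (X k - M) *m N
      + M *m (Y k - N).
    by rewrite -mulmxDr subrK mulmxBl mulmxBr addrA subrK.
  apply: (le_trans (mxnorm1D _ _)); apply: lerD; last exact: mxnorm1M.
  by apply: (le_trans (mxnorm1D _ _)); apply: lerD; exact: mxnorm1M.
rewrite [X in _ --> X](_ : 0 = 0 * 0 + 0 * mxnorm1 N + mxnorm1 M * 0); last by ring.
by apply: cvgD; [apply: cvgD; [exact: cvgM|exact: cvgMl]|exact: cvgMr].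
Qed.

Lemma mxcvg_sum m p (I : Type) (s : seq I) (X : I -> nat -> 'M[R[i]]_(m, p)) M :
  (forall i, mxcvg (X i) (M i)) ->
  mxcvg (fun k => \sum_(i <- s) X i k) (\sum_(i <- s) M i).
Proof.
move=> XM; elim: s => [|i s IHs].
  by rewrite big_nil; under eq_fun do rewrite big_nil; exact: mxcvg_cst.
by rewrite big_cons; under eq_fun do rewrite big_cons; exact: mxcvgD.
Qed.

Lemma mxcvg_prod n (I : Type) (s : seq I) (X : I -> nat -> 'M[R[i]]_n) M :
  (forall i, mxcvg (X i) (M i)) ->
  mxcvg (fun k => \prod_(i <- s) X i k) (\prod_(i <- s) M i).
Proof.
move=> XM; elim: s => [|i s IHs].
  by rewrite big_nil; under eq_fun do rewrite big_nil; exact: mxcvg_cst.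
by rewrite big_cons; under eq_fun do rewrite big_cons; exact: mxcvgM.
Qed.

Lemma nceval_continuous n (q : ncpoly R d) (Z : nat -> mtuple R d n)
    (T : mtuple R d n) :
  (forall r, mxcvg (fun k => Z k r) (T r)) ->
  mxcvg (fun k => nceval q (Z k)) (nceval q T).
Proof.
by move=> ZT; apply: mxcvg_sum => w; apply: mxcvgZ; exact: mxcvg_prod.
Qed.

Lemma mxcvgE m p (X : nat -> 'M[R[i]]_(m, p)) M : mxcvg X M <-> X @ \oo --> M.
Proof.
rewrite cvg_mxP; split=> [/cvgrPdist_le XM e e0|XM].
  apply: filterS (XM e e0) => k.
  by rewrite sub0r normrN ger0_norm ?mxnorm1_ge0// mxnorm1BC.
apply/cvgrPdist_le => e e0; apply: filterS (XM e e0) => k.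
by rewrite sub0r normrN ger0_norm ?mxnorm1_ge0// mxnorm1BC.
Qed.

Lemma tuple_cvg n (Z : nat -> mtuple R d n) (T : mtuple R d n) :
  (Z @ \oo --> T) <-> forall r, mxcvg (fun k => Z k r) (T r).
Proof.
split=> ZT => [r|].
  apply/mxcvgE => A TA.
  exact: ZT (@proj_continuous _ (fun=> 'M[R[i]]_n) r T A TA).
apply/cvg_sup => r A; rewrite nbhsE => -[B [[U oU <-] TU] BA].
rewrite nbhs_filterE; apply: filterS BA _; have /mxcvgE := ZT r.
by apply; exact: open_nbhs_nbhs.
Qed.

Lemma mxnorm1_mxblock n (B : 'I_J -> 'I_J -> 'M[R[i]]_n) :
  mxnorm1 (\mxblock_(i < J, j < J) B i j) = \sum_i \sum_j mxnorm1 (B i j).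
Proof.
rewrite /mxnorm1 (reindex (@ten_idx J n))/=; last exact: onW_bij (ten_idx_bij J n).
transitivity (\sum_(p : 'I_J * 'I_n) \sum_j \sum_l absR (B p.1 j p.2 l)).
  apply: eq_bigr => p _.
  rewrite (reindex (@ten_idx J n))/=; last exact: onW_bij (ten_idx_bij J n).
  rewrite pair_bigA; apply: eq_bigr => q _.
  have := congr1 (fun M : 'M[R[i]]_n => M p.2 q.2) (mxblockK B p.1 q.1).
  by rewrite [X in X = _ -> _]mxE => ->.
rewrite -(pair_bigA _ (fun i k => \sum_j \sum_l absR (B i j k l)))/=.
by apply: eq_bigr => i _; rewrite exchange_big.
Qed.

Lemma cvg_sum0 (I : finType) (f : I -> nat -> R) :
  (forall i, f i @ \oo --> 0) -> (fun k => \sum_i f i k) @ \oo --> 0.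
Proof.
move=> f0; elim: (index_enum I) => [|i s IHs].
  by under eq_fun do rewrite big_nil; exact: cvg_cst.
under eq_fun do rewrite big_cons.
by have := cvgD (f0 i) IHs; rewrite addr0; exact.
Qed.

Lemma deval_continuous (delta : 'M[ncpoly R d]_J) n (Z : nat -> mtuple R d n)
    (T : mtuple R d n) :
  (forall r, mxcvg (fun k => Z k r) (T r)) ->
  mxcvg (fun k => deval delta (Z k)) (deval delta T).
Proof.
move=> ZT; apply: (@mxcvg_le _ _ _ _ (fun k => \sum_(i < J) \sum_(j < J)
    mxnorm1 (nceval (delta i j) (Z k) - nceval (delta i j) T))).
  by move=> k; rewrite /deval -mxblockB mxnorm1_mxblock.
apply: cvg_sum0 => i; apply: cvg_sum0 => j.
exact: (nceval_continuous (delta i j) ZT).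
Qed.

End limits.

(** * Bounded approximate solutions *)

Section approximate_solutions.
Variables (R : realType) (E : hilbertType R) (J n : nat).
Implicit Types (x y : hten E J n).

Definition normR (z : E) : R := complex.Re `|z|.

Lemma normRE z : `|z| = (normR z)%:C%C.
Proof. by rewrite /normR RRe_real ?normr_real. Qed.

Lemma normR_ge0 z : 0 <= normR z.
Proof. by rewrite -ler0c -normRE. Qed.

Lemma hten_norm_le_sum x : hten_norm x <= \sum_p normR (x p).
Proof.
rewrite hten_norm_leE; last by apply: sumr_ge0 => p _; exact: normR_ge0.
apply: le_trans (sum_sqr_le _); last by move=> p; exact: normR_ge0.
rewrite -lecR hten_sqnorm_sum rmorph_sum/=; apply: ler_sum => p _.
by rewrite rmorphXn/= -normRE.
Qed.

Lemma hten_complete (y : nat -> hten E J n) :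
  (forall e : R, 0 < e ->
    exists N, \forall k \near \oo, hten_norm (y k - y N) <= e) ->
  exists x, forall e : R, 0 < e -> \forall k \near \oo, hten_norm (y k - x) <= e.
Proof.
move=> yc.
have ReC (e : R[i]) : 0 < e -> e = (complex.Re e)%:C%C /\ 0 < complex.Re e.
  move=> e0; have eE : e = (complex.Re e)%:C%C by rewrite RRe_real// gtr0_real.
  by rewrite -ltcR -eE.
have cv p : cvgn (fun k => y k p).
  apply: cauchy_cvg; apply: cauchy_exP => e /ReC[eE e0].
  have [N yN] := yc _ (divr_gt0 e0 (ltr0n _ 2)).
  exists (y N p); apply: filterS yN => k /= ykN.
  rewrite -ball_normE/= eE; apply: (@le_lt_trans _ _ (complex.Re e / 2)%:C%C).
    rewrite distrC; apply: le_trans (_ : (hten_norm (y k - y N))%:C%C <= _).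
      by have := hten_norm_coord (y k - y N) p; rewrite !ffunE.
    by rewrite lecR.
  by rewrite ltcR ltr_pdivrMr// ltr_pMr ?ltr1n.
exists [ffun p => lim ((fun k => y k p) @ \oo)] => e e0.
set N := #|{: 'I_J * 'I_n}|.
have c0 : 0 < e / (N%:R + 1) by rewrite divr_gt0// ltr_wpDl.
have Fp p : \forall k \near \oo,
    `|y k p - lim ((fun k => y k p) @ \oo)| <= (e / (N%:R + 1))%:C%C.
  have cC : 0 < (e / (N%:R + 1))%:C%C by rewrite ltcR.
  have /cvgrPdist_le/(_ _ cC) := cv p.
  by apply: filterS => k; rewrite distrC.
have Fall : \forall k \near \oo, forall p,
    `|y k p - lim ((fun k => y k p) @ \oo)| <= (e / (N%:R + 1))%:C%C.
  exact: filter_forall.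
apply: filterS Fall => k yk; apply: (le_trans (hten_norm_le_sum _)).
apply: (@le_trans _ _ (\sum_(p : 'I_J * 'I_n) e / (N%:R + 1))).
  by apply: ler_sum => p _; rewrite -lecR -normRE !ffunE yk.
rewrite sumr_const -/N -[leLHS]mulr_natr -mulrA ler_piMr ?ltW//.
by rewrite mulrC ltr_pdivrMr ?ltr_wpDl// mul1r ltrDl.
Qed.

(** In a Hilbert space, bounded approximate solutions of a continuous linear
    equation produce a solution. This would follow from weak compactness of
    balls; the argument here is that near-minimal elements of the decreasing
    closed convex sets {x : |L x - c| <= 1/(k+1)} form a Cauchy sequence, because
    the least norms of these sets increase to a finite limit. *)
Lemma approx_solution (L : hten E J n -> hten E J n) (K M : R) (c : hten E J n)
    (w : nat -> hten E J n) :
  linear L -> 0 <= K -> (forall x, hten_norm (L x) <= K * hten_norm x) ->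
  (forall k, hten_norm (w k) <= M) ->
  (fun k => hten_norm (L (w k) - c)) @ \oo --> (0 : R) ->
  exists x, L x = c.
Proof.
move=> Llin K0 LK wM wc.
pose S k := [set x | hten_norm (L x - c) <= k.+1%:R^-1].
have Sw k : exists2 x, S k x & hten_sqnorm x <= M ^+ 2.
  move/cvgrPdist_le : wc => /(_ k.+1%:R^-1).
  rewrite invr_gt0 ltr0n => /(_ isT)[j _ /(_ j)].
  move=> /(_ (leqnn j)); rewrite /= sub0r normrN ger0_norm ?hten_norm_ge0// => wj.
  exists (w j) => //; rewrite -sqr_hten_norm ler_pXn2r ?nnegrE ?hten_norm_ge0//.
  exact: le_trans (hten_norm_ge0 (w j)) (wM j).
pose V k := [set hten_sqnorm x | x in S k].
have Vinf k : has_inf (V k).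
  split; first by have [x Sx _] := Sw k; exists (hten_sqnorm x), x.
  by exists 0 => _ [x _ <-]; exact: hten_sqnorm_ge0.
pose m k := inf (V k).
have m_le k x : S k x -> m k <= hten_sqnorm x.
  by move=> Sx; apply: inf_lbound; [case: (Vinf k)|exists x].
have mM k : m k <= M ^+ 2 by have [x Sx] := Sw k; apply: le_trans; exact: m_le.
have Smono k l : (k <= l)%N -> S l `<=` S k.
  move=> kl x /le_trans; apply.
  by rewrite lef_pV2 ?posrE ?ltr0n// ler_nat ltnS.
have mmono : nondecreasing_seq m.
  move=> k l kl; apply: lb_le_inf; first by case: (Vinf l).
  by move=> _ [x Sx <-]; apply: m_le; exact: Smono Sx.
have mub : has_ubound (range m) by exists (M ^+ 2) => _ [k _ <-].
have := nondecreasing_cvgn mmono mub; set s := sup _ => ms.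
have m_s k : m k <= s by apply: ub_le_sup => //; exists k.
have [y yS ym] : exists2 y, forall k, S k (y k) &
    forall k, hten_sqnorm (y k) <= m k + k.+1%:R^-1.
  have h k : exists x, S k x /\ hten_sqnorm x <= m k + k.+1%:R^-1.
    have /inf_adherent/(_ (Vinf k))[_ [x Sx <-] /ltW xm] : 0 < k.+1%:R^-1 :> R.
      by rewrite invr_gt0.
    by exists x.
  by have [y yP] := choice h; exists y => k; have [] := yP k.
(* The midpoint of y l and y k stays in the convex set S k, so its square norm
   is at least m k; the parallelogram identity turns this into a bound on the
   distance between y l and y k. *)
have ydist k l : (k <= l)%N ->
    hten_sqnorm (y l - y k) <= 2 * (s - m k) + 4 * k.+1%:R^-1.
  move=> kl; rewrite hten_parallelogram.
  have Smid : S k (2^-1 *: (y l + y k)).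
    rewrite /S/=.
    have -> : L (2^-1 *: (y l + y k)) - c
        = 2^-1 *: ((L (y l) - c) + (L (y k) - c)).
      have L0 : L 0 = 0 by have := Llin (-1) 0 0; rewrite !scaleN1r !addNr.
      rewrite -[2^-1 *: _ in LHS]addr0 Llin L0 addr0 -{1}[y l]scale1r Llin scale1r.
      have c2 : 2^-1 *: (c + c) = c.
        by rewrite -mulr2n -[c *+ 2](scaler_nat (R := R[i])) scalerA mulVf ?scale1r.
      by rewrite addrACA -opprD scalerBr c2.
    rewrite hten_normZ /absR normfV normr_nat.
    have -> : complex.Re (2^-1 : R[i]) = 2^-1.
      by rewrite -[2](rmorph_nat (real_complex R)) -fmorphV.
    rewrite mulrC ler_pdivrMr// mulr_natr mulr2n.
    apply: (le_trans (hten_normD _ _)).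
    by apply: lerD; [exact: Smono (yS l)|exact: yS].
  have := m_le _ _ Smid; rewrite hten_sqnormZ.
  have -> : absR (2^-1 : R[i]) = 2^-1.
    rewrite /absR normfV normr_nat.
    by rewrite -[2](rmorph_nat (real_complex R)) -fmorphV.
  have := ym k; have := ym l; have := m_s l.
  have : l.+1%:R^-1 <= k.+1%:R^-1 :> R.
    by rewrite lef_pV2 ?posrE ?ltr0n// ler_nat ltnS.
  move: (hten_sqnorm _) (hten_sqnorm _) (hten_sqnorm _) (m k) (m l).
  move: (k.+1%:R^-1) (l.+1%:R^-1) => *; lra.
have [|x xy] := @hten_complete y.
  move=> e e0.
  have e2 : 0 < e ^+ 2 / 8 by rewrite divr_gt0// exprn_gt0.
  have /cvgrPdist_le/(_ _ e2) := ms.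
  have /cvgrPdist_le/(_ _ e2) := @cvg_harmonic R.
  move=> [N1 _ h1] [N2 _ h2]; exists (maxn N1 N2).
  exists (maxn N1 N2) => // k /= kN; rewrite hten_norm_leE; last exact: ltW.
  apply: (le_trans (ydist _ _ kN)).
  have := h1 (maxn N1 N2) (leq_maxl _ _); have := h2 (maxn N1 N2) (leq_maxr _ _).
  rewrite /= sub0r normrN !ger0_norm ?subr_ge0// ?invr_ge0// /harmonic/=.
  move: e2; move: (m _) ((maxn N1 N2).+1%:R^-1) (e ^+ 2) => *; lra.
exists x; apply/eqP; rewrite -subr_eq0; apply/eqP/hten_norm_eq0/eqP.
rewrite eq_le hten_norm_ge0 andbT; apply/ler_addgt0Pl => e e0; rewrite addr0.
have e1 : 0 < e / (2 * (K + 1)) by rewrite divr_gt0// mulr_gt0// ltr_wpDl.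
have e2 : 0 < e / 2 by rewrite divr_gt0.
have [N1 _ h1] := xy _ e1.
have /cvgrPdist_le/(_ _ e2)[N2 _ h2] := @cvg_harmonic R.
have {}h1 := h1 (maxn N1 N2) (leq_maxl _ _).
have {}h2 := h2 (maxn N1 N2) (leq_maxr _ _).
move: h1 h2; set k := maxn N1 N2 => h1.
rewrite /= sub0r normrN ger0_norm ?invr_ge0// /harmonic/= => h2.
have -> : L x - c = (L (y k) - c) - L (y k - x).
  have -> : y k - x = (-1) *: x + y k by rewrite scaleN1r addrC.
  by rewrite Llin scaleN1r opprD opprK [RHS]addrC addrA subrK.
apply: (le_trans (hten_normB _ _)).
have -> : e = e / 2 + e / 2 by field.
apply: lerD; first exact: le_trans (yS k) h2.
apply: (le_trans (LK _)); apply: (le_trans (ler_wpM2l K0 h1)).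
have K1 : 0 < K + 1 by rewrite ltr_wpDl.
have -> : K * (e / (2 * (K + 1))) = e / 2 * (K / (K + 1)).
  by field; rewrite gt_eqF.
by rewrite ler_piMr ?(ltW e2)// ler_pdivrMr// mul1r lerDl.
Qed.

End approximate_solutions.

(** * Realizations and models *)

Section linear_combination.
Variables (R : realType) (E : hilbertType R) (J n : nat) (v : 'I_n -> hten E J n).

Definition lin_comb (a : 'cV[R[i]]_n) : hten E J n := \sum_k a k 0 *: v k.

Lemma lin_comb_linear : linear lin_comb.
Proof.
move=> c a b; rewrite /lin_comb scaler_sumr -big_split/=.
by apply: eq_bigr => k _; rewrite !mxE scalerDl scalerA.
Qed.

HB.instance Definition _ := GRing.isLinear.Build R[i] 'cV[R[i]]_n (hten E J n)
  _ lin_comb lin_comb_linear.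

End linear_combination.

Section realization_facts.
Variables (R : realType) (E : hilbertType R) (J n : nat).
Variables (D : {linear hvec E J -> hvec E J}) (C : {linear R[i]^o -> hvec E J}).
Implicit Types (v : hten E J n) (X : 'M[R[i]]_(\sum_(i < J) n)).

(** The operator I - (D (x) I)(I (x) X); at X = delta(T) it is the one whose range
    decides whether T is a B-point. *)
Definition pencil X v : hten E J n := v - D_tens D (idE_tens X v).

Lemma pencil_linear X : linear (pencil X).
Proof.
move=> a v w; rewrite /pencil idE_tens_linear D_tens_linear scalerBr opprD.
by rewrite addrACA.
Qed.

Lemma C_tens_basis (a : 'cV[R[i]]_n) :
  C_tens C a = \sum_k a k 0 *: C_tens C (delta_mx k 0) :> hten E J n.
Proof.
apply/ffunP => p; rewrite sum_ffunE !ffunE (bigD1 p.2)//= [X in _ = _ + X]big1.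
  rewrite addr0 !ffunE !mxE !eqxx -[a _ _ in LHS]mulr1.
    have -> : C (a p.2 0 * 1) = a p.2 0 *: C (1 : R[i]^o) by exact: linearZ.
  by rewrite ffunE.
by move=> k kp; rewrite !ffunE !mxE eq_sym (negbTE kp) linear0 ffunE scaler0.
Qed.

Hypothesis Dle : forall x : hvec E J, hvec_sqnorm (D x) <= hvec_sqnorm x.

Lemma hten_norm_D_idE_tens X v :
  hten_norm (D_tens D (idE_tens X v)) <= opnorm X * hten_norm v.
Proof. exact: le_trans (hten_norm_D_tens _ Dle) (hten_norm_idE_tens _ _). Qed.

Lemma hten_norm_pencil X v : hten_norm (pencil X v) <= (1 + opnorm X) * hten_norm v.
Proof.
by rewrite (le_trans (hten_normB _ _))// mulrDl mul1r lerD2l hten_norm_D_idE_tens.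
Qed.

Lemma pencilB X Y v : pencil X v - pencil Y v = D_tens D (idE_tens (Y - X) v).
Proof.
by rewrite /pencil idE_tensB [RHS]linearB/= opprB [LHS]addrC addrA subrK.
Qed.

End realization_facts.

Section model_facts.
Variables (R : realType) (d J : nat) (delta : 'M[ncpoly R d]_J).
Variables (phi : gradedfun R d) (E : hilbertType R) (u : hgradedfun d E J).
Hypothesis u_model : nc_model delta phi u.

Lemma model_entry n (x : mtuple R d n) i k : Gdelta delta x ->
  (1%:M - (phi x) ^t* *m phi x) i k =
  hten_dot (idE_tens (1%:M - (deval delta x) ^t* *m deval delta x)
              (u x (delta_mx k 0))) (u x (delta_mx i 0)).
Proof.
move=> Gx; have [_ _ /(_ n x x (delta_mx k 0) Gx Gx)] := u_model.
by move=> /matrixP/(_ i 0); rewrite -colE !mxE.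
Qed.

(** The model identity at y = x gives
    I - phi(x)^* phi(x) >= (1 - |delta(x)|^2) u(x)^* u(x). *)
Lemma model_bound n (x : mtuple R d n) k : Gdelta delta x ->
  hten_sqnorm (u x (delta_mx k 0)) <=
  opnorm (1%:M - (phi x) ^t* *m phi x) / (1 - opnorm (deval delta x) ^+ 2).
Proof.
move=> Gx; have q1 : 0 < 1 - opnorm (deval delta x) ^+ 2.
  rewrite subr_gt0 -(expr1n _ 2%N) ltr_pXn2r ?nnegrE ?opnorm_ge0//.
  by case: Gx.
rewrite ler_pdivlMr//; apply: le_trans (opnorm_entry _ k k).
apply: le_trans (Re_le_absR _); rewrite (model_entry _ _ Gx).
set w := u x _; rewrite idE_tensB idE_tens1 hten_dotDl hten_dotNl idE_tensM.
rewrite idE_tens_adj trmxCK !hten_sqnormE -rmorphB/= mulrBr mulr1 lerD2l lerN2.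
rewrite mulrC -sqr_hten_norm -[hten_sqnorm w]sqr_hten_norm -exprMn.
rewrite ler_pXn2r ?nnegrE ?hten_norm_ge0 ?hten_norm_idE_tens//.
by rewrite mulr_ge0 ?opnorm_ge0 ?hten_norm_ge0.
Qed.

(** In the opposite direction, the model identity bounds the defect of phi(x) by
    that of delta(x) as soon as u(x) is bounded. *)
Lemma opnorm_defect n (x : mtuple R d n) (r : 'I_n -> R) : Gdelta delta x ->
  (forall k, hten_norm (u x (delta_mx k 0)) <= r k) ->
  opnorm (1%:M - (phi x) ^t* *m phi x) <=
  mxnorm1 (1%:M - (deval delta x) ^t* *m deval delta x) * (\sum_k r k) ^+ 2.
Proof.
move=> Gx ur; apply: (le_trans (opnorm_le_mxnorm1 _)).
set X := 1%:M - (phi x) ^t* *m _.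
set Y := mxnorm1 (_ - (deval delta x) ^t* *m _).
have -> : Y * (\sum_k r k) ^+ 2 = \sum_i \sum_k Y * r k * r i.
  rewrite expr2 mulrA mulr_sumr; apply: eq_bigr => i _.
  by rewrite mulr_sumr mulr_suml.
apply: ler_sum => i _; apply: ler_sum => k _.
rewrite /X (model_entry _ _ Gx); apply: (le_trans (hten_cauchy_schwarz _ _)).
apply: ler_pM; rewrite ?hten_norm_ge0//.
apply: (le_trans (hten_norm_idE_tens _ _)).
apply: ler_pM; rewrite ?hten_norm_ge0 ?opnorm_ge0//.
exact: opnorm_le_mxnorm1.
Qed.

End model_facts.

(** * Perturbing an isometry in an inward direction *)

Section inward_perturbation.
Variable R : realType.

(** The form of the hermitian matrix X^* X - 1 vanishes identically, hence so do
    its eigenvalues. *)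
Lemma isometry_adjmx m (X : 'M[R[i]]_m) :
  (forall v, vnorm (X *m v) = vnorm v) -> X ^t* *m X = 1%:M.
Proof.
move=> Xiso; apply/eqP; rewrite -subr_eq0; apply/eqP.
set M := X ^t* *m X - 1%:M.
have [|P [dg [PP ME dgE]]] := @herm_spectral _ _ M.
  by rewrite linearB/= map_mxB -/(_ ^t*) adjmxM trmxCK -/(_ ^t*) adjmx1.
rewrite ME; suff -> : dg = 0 by rewrite [diag_mx 0]linear0 mulmx0 mul0mx.
apply/rowP => k; rewrite mxE; have [v [_ <-]] := dgE k.
by rewrite /M qformD -scaleN1r qformZ qform1 -vnormM Xiso mulN1r subrr.
Qed.

(** The two first order terms N^* X0 and X0^* N coincide, as X0^* N is
    hermitian; W collects the terms of order at least two. *)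
Lemma gram_expansion m (X0 N Q : 'M[R[i]]_m) (t K : R) :
  X0 ^t* *m X0 = 1%:M -> (X0 ^t* *m N) ^t* = X0 ^t* *m N ->
  0 <= t -> t <= 1 -> 0 <= K -> mxnorm1 Q <= K ->
  let X := X0 + t%:C%C *: N + (t%:C%C) ^+ 2 *: Q in
  exists2 W,
    X ^t* *m X = 1%:M + (2 * t)%:C%C *: (X0 ^t* *m N) + (t ^+ 2)%:C%C *: W &
    mxnorm1 W <= 2 * mxnorm1 X0 * K + mxnorm1 N ^+ 2 + 2 * mxnorm1 N * K + K ^+ 2.
Proof.
move=> X0iso Nh t0 t1 K0 QK X; set tC := t%:C%C in X *.
have tCc : tC^* = tC by exact: conjc_real.
have adjD (P S : 'M[R[i]]_m) : (P + S) ^t* = P ^t* + S ^t*.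
  by rewrite linearD/= map_mxD.
have adjZ a (P : 'M[R[i]]_m) : (a *: P) ^t* = a^* *: P ^t*.
  by rewrite linearZ/= map_mxZ.
exists (X0 ^t* *m Q + Q ^t* *m X0 + N ^t* *m N
        + tC *: (N ^t* *m Q + Q ^t* *m N) + tC ^+ 2 *: (Q ^t* *m Q)).
  have Nh' : N ^t* *m X0 = X0 ^t* *m N by rewrite -[RHS]Nh adjmxM trmxCK.
  rewrite /X !adjD !adjZ rmorphXn/= tCc !mulmxDl !mulmxDr.
  rewrite -!scalemxAl -!scalemxAr X0iso Nh' !scalerA.
  rewrite rmorphM rmorphXn/= -/tC rmorph_nat.
  move: (X0 ^t* *m N) (X0 ^t* *m Q) (Q ^t* *m X0) => a b c.
  move: (N ^t* *m N) (N ^t* *m Q) (Q ^t* *m N) (Q ^t* *m Q) => e f g h.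
  by apply/matrixP => i j; rewrite !mxE; ring.
have K2 : mxnorm1 Q * mxnorm1 Q <= K ^+ 2 by rewrite expr2 ler_pM ?mxnorm1_ge0.
have t2 : absR (tC ^+ 2) <= 1.
  by rewrite -rmorphXn absR_real ?sqr_ge0// exprn_ile1.
have tC1 : absR tC <= 1 by rewrite absR_real.
apply: (le_trans (mxnorm1D _ _)); apply: lerD; last first.
  rewrite mxnorm1Z.
  apply: (@le_trans _ _ (1 * (mxnorm1 Q * mxnorm1 Q))); last by rewrite mul1r.
  apply: ler_pM; rewrite ?absR_ge0 ?mxnorm1_ge0//.
  by apply: (le_trans (mxnorm1M _ _)); rewrite mxnorm1_adj.
apply: (le_trans (mxnorm1D _ _)); apply: lerD; last first.
  rewrite mxnorm1Z -mulrA mulr_natl -[leRHS]mul1r.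
  apply: ler_pM; rewrite ?absR_ge0 ?mxnorm1_ge0//.
  rewrite mulr2n; apply: (le_trans (mxnorm1D _ _)); apply: lerD.
    apply: (le_trans (mxnorm1M _ _)); rewrite mxnorm1_adj.
    by apply: ler_pM; rewrite ?mxnorm1_ge0.
  apply: (le_trans (mxnorm1M _ _)); rewrite mxnorm1_adj mulrC.
  by apply: ler_pM; rewrite ?mxnorm1_ge0.
apply: (le_trans (mxnorm1D _ _)); apply: lerD; last first.
  by apply: (le_trans (mxnorm1M _ _)); rewrite mxnorm1_adj expr2.
rewrite -mulrA mulr_natl mulr2n; apply: (le_trans (mxnorm1D _ _)); apply: lerD.
  apply: (le_trans (mxnorm1M _ _)); rewrite mxnorm1_adj.
  by apply: ler_pM; rewrite ?mxnorm1_ge0.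
apply: (le_trans (mxnorm1M _ _)); rewrite mxnorm1_adj mulrC.
by apply: ler_pM; rewrite ?mxnorm1_ge0.
Qed.

Lemma opnorm_sqr_le m (X : 'M[R[i]]_m) (c : R) : 0 <= c ->
  (forall v, vnorm (X *m v) ^+ 2 <= c * vnorm v ^+ 2) -> opnorm X ^+ 2 <= c.
Proof.
move=> c0 Xc; rewrite -[leRHS](sqr_sqrtr c0).
rewrite ler_pXn2r ?nnegrE ?opnorm_ge0 ?sqrtr_ge0//.
apply: opnorm_le; rewrite ?sqrtr_ge0// => v.
rewrite -(ler_pXn2r (ltn0Sn 1)) ?nnegrE ?mulr_ge0 ?sqrtr_ge0 ?vnorm_ge0//.
by rewrite exprMn (sqr_sqrtr c0) Xc.
Qed.

(** With X0^* N <= -c, the expansion X^* X = 1 + 2 t X0^* N + O(t^2) shows that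
    the norm of X drops below 1 at least linearly in t, while X moves and loses
    isometricity at most linearly. *)
Lemma inward_estimate m (X0 N : 'M[R[i]]_m) (K : R) :
  X0 ^t* *m X0 = 1%:M -> negdef (X0 ^t* *m N) -> 0 <= K ->
  exists t0 c K' : R, [/\ 0 < t0, t0 <= 1, 0 < c, 0 <= K' &
    forall t Q, 0 < t -> t <= t0 -> mxnorm1 Q <= K ->
    let X := X0 + t%:C%C *: N + (t%:C%C) ^+ 2 *: Q in
    [/\ c * t <= 1 - opnorm X ^+ 2, opnorm X < 1,
        mxnorm1 (1%:M - X ^t* *m X) <= K' * t &
        mxnorm1 (X - X0) <= K' * t]].
Proof.
move=> X0iso Nneg K0; have [Nh _] := Nneg.
have [c c0 cN] := negdef_coercive Nneg.
pose K1 := 2 * mxnorm1 X0 * K + mxnorm1 N ^+ 2 + 2 * mxnorm1 N * K + K ^+ 2.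
have K1_ge0 : 0 <= K1 by rewrite /K1 !addr_ge0 ?mulr_ge0 ?exprn_ge0 ?mxnorm1_ge0.
(* Below c / (K1 + 1) the second order term uses up at most half of the gain
   2 c t, and below c^-1 the bound 1 - c t on |X|^2 is nonnegative. *)
pose t0 := Num.min 1 (Num.min (c / (K1 + 1)) c^-1).
have t0_gt0 : 0 < t0 by rewrite !lt_min ltr01 invr_gt0 c0 divr_gt0// ltr_wpDl.
pose K' := 2 * mxnorm1 (X0 ^t* *m N) + K1 + mxnorm1 N + K.
exists t0, c, K'; split=> //.
- by rewrite ge_min lexx.
- by rewrite /K' !addr_ge0 ?mulr_ge0 ?mxnorm1_ge0.
move=> t Q t_gt0; rewrite !le_min => /and3P[t1 tc tc1] QK X.
have t_ge0 := ltW t_gt0.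
have [W XX WK] := gram_expansion X0iso Nh t_ge0 t1 K0 QK.
have tK1 : t * K1 <= c.
  move: tc; rewrite ler_pdivlMr ?ltr_wpDl// mulrDr mulr1 => /(le_trans _); apply.
  by rewrite lerDl.
have ct1 : c * t <= 1 by rewrite mulrC -ler_pdivlMr// mul1r.
have Xsq : opnorm X ^+ 2 <= 1 - c * t.
  apply: opnorm_sqr_le; first by rewrite subr_ge0.
  move=> v; have /(congr1 (@complex.Re R)) := vnormM X v.
  have ReZ (a : R) (z : R[i]) : complex.Re (a%:C%C * z) = a * complex.Re z.
    by case: z => x y /=; rewrite mul0r subr0.
  rewrite XX !qformD qform1 !qformZ 2!raddfD/= !ReZ => ->.
  have := cN v; rewrite lecE/= => /andP[_ Nv].
  have Wv := le_trans (Re_le_absR _) (absR_qform W v).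
  have {}Wv := le_trans Wv (ler_wpM2r (sqr_ge0 (vnorm v)) WK).
  have h1 := ler_wpM2l t_ge0 Nv.
  have h2 := ler_wpM2l (sqr_ge0 t) Wv.
  have h3 := ler_wpM2r (mulr_ge0 t_ge0 (sqr_ge0 (vnorm v))) tK1.
  move: h1 h2 h3; rewrite -/K1.
  move: (complex.Re _) (complex.Re _) (vnorm v ^+ 2) => a b r; lra.
have q0 := opnorm_ge0 X.
have q1 : opnorm X < 1.
  rewrite -(ltr_pXn2r (ltn0Sn 1)) ?nnegrE// expr1n (le_lt_trans Xsq)//.
  by rewrite gtrBl mulr_gt0.
split=> //; first by rewrite lerBrDr addrC -lerBrDr.
  rewrite XX -addrA opprD addrA subrr add0r -scaleN1r mxnorm1Z.
  rewrite /absR normrN normr1 mul1r.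
  apply: (le_trans (mxnorm1D _ _)).
  rewrite !mxnorm1Z !absR_real ?sqr_ge0 ?mulr_ge0//.
  have h1 : t ^+ 2 * mxnorm1 W <= t * K1.
    rewrite expr2 -mulrA ler_wpM2l//; apply: le_trans (_ : 1 * mxnorm1 W <= _).
      by rewrite ler_wpM2r ?mxnorm1_ge0.
    by rewrite mul1r.
  have h2 : 0 <= (mxnorm1 N + K) * t by rewrite mulr_ge0 ?addr_ge0 ?mxnorm1_ge0.
  rewrite /K'; move: h1 h2; move: (t ^+ 2 * _) => a; lra.
rewrite /X -[Y in Y - _]addrA [Y in Y - _]addrC addrK.
rewrite (le_trans (mxnorm1D _ _))// !mxnorm1Z -rmorphXn !absR_real ?sqr_ge0//.
have h1 : t ^+ 2 * mxnorm1 Q <= t * K.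
  rewrite expr2 -mulrA ler_wpM2l//; apply: le_trans (_ : 1 * mxnorm1 Q <= _).
    by rewrite ler_wpM2r ?mxnorm1_ge0.
  by rewrite mul1r.
have h2 : 0 <= (2 * mxnorm1 (X0 ^t* *m N) + K1) * t.
  by rewrite mulr_ge0 ?addr_ge0 ?mulr_ge0 ?mxnorm1_ge0.
rewrite /K'; move: h1 h2; move: (t ^+ 2 * _) => a; lra.
Qed.

End inward_perturbation.

(** * The two implications *)

(** T is a limit of points of Gdelta, where the dimension is positive. *)
Lemma Idelta_dim_gt0 (R : realType) (d J n : nat)
    (delta : 'M[ncpoly R d]_J) (T : mtuple R d n) : Idelta delta T -> (0 < n)%N.
Proof.
by move=> [[+ _] _] => /(_ setT filterT)[x [[n0 _] _]].
Qed.

Section realized_model.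
Variables (R : realType) (d J : nat) (delta : 'M[ncpoly R d]_J).
Variables (phi : gradedfun R d) (E : hilbertType R) (u : hgradedfun d E J).
Hypothesis u_model : nc_model delta phi u.
Variables (A : R[i]) (B : {scalar hvec E J}) (C : {linear R[i]^o -> hvec E J})
  (D : {linear hvec E J -> hvec E J}).
Hypothesis ABCD : realization delta phi u A B C D.

(** The isometry condition at z = 0. *)
Lemma realization_contraction (x : hvec E J) :
  hvec_sqnorm (D x) <= hvec_sqnorm x.
Proof.
have [/(_ 0 x) + _ _] := ABCD; rewrite normr0 expr0n/= add0r linear0 add0r => <-.
by rewrite lerDr exprn_ge0.
Qed.

Let Dle := realization_contraction.

Lemma realization_pencil n (x : mtuple R d n) a : Gdelta delta x ->
  pencil D (deval delta x) (u x a) = C_tens C a.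
Proof. by move=> Gx; have [_ + _] := ABCD; exact. Qed.

(** The right-hand side is linear in a, so it is enough to solve for the basis
    vectors of C^n one at a time. *)
Lemma in_Ran_basis n (X : 'M[R[i]]_(\sum_(i < J) n)) :
  (forall k, exists v : hten E J n, pencil D X v = C_tens C (delta_mx k 0)) ->
  in_Ran (C_tens C : 'cV_n -> hten E J n) (pencil D X).
Proof.
move=> /choice[v vE]; exists (lin_comb v) => a.
rewrite (C_tens_basis C a) /=.
have pS (s : seq 'I_n) : pencil D X (\sum_(k <- s) a k 0 *: v k) =
    \sum_(k <- s) a k 0 *: pencil D X (v k).
  elim: s => [|k s IHs].
    by rewrite !big_nil /pencil [idE_tens _ 0]linear0 [D_tens _ 0]linear0 subr0.
  by rewrite !big_cons pencil_linear IHs.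
by rewrite [LHS]pS; apply: eq_bigr => k _; rewrite vE.
Qed.

(** Each u(Z j) solves the equation with delta(Z j) instead of delta(T). The
    B-point condition keeps these vectors bounded, so they are approximate
    solutions of the equation at T and approx_solution applies. *)
Lemma B_point_in_Ran n (T : mtuple R d n) : B_point delta phi T ->
  in_Ran (C_tens C : 'cV_n -> hten E J n) (pencil D (deval delta T)).
Proof.
move=> [_ [Z [GZ /tuple_cvg/(deval_continuous delta) ZT ratio]]].
apply: in_Ran_basis => k.
have [M M0 ratioM] : exists2 M : R, 0 <= M & forall j,
    opnorm (1%:M - (phi (Z j)) ^t* *m phi (Z j))
    / (1 - opnorm (deval delta (Z j)) ^+ 2) <= M.
  have [M [_ MP]] := cvg_seq_bounded ratio.
  exists (`|M| + 1) => [|j]; first by rewrite addr_ge0.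
  apply: le_trans (ler_norm _) _; apply: MP => //.
  by rewrite (le_lt_trans (ler_norm M))// ltrDl.
pose w j := u (Z j) (delta_mx k 0).
have wM j : hten_norm (w j) <= Num.sqrt M.
  rewrite /hten_norm ler_wsqrtr//; apply: le_trans (ratioM j).
  exact: (model_bound u_model).
pose K := 1 + opnorm (deval delta T).
apply: (@approx_solution _ _ _ _ _ K (Num.sqrt M) _ w) => //.
- exact: pencil_linear.
- by rewrite addr_ge0// opnorm_ge0.
- by move=> x; exact: hten_norm_pencil.
apply: (@squeeze_cvgr _ _ _ _ (cst 0)
  (fun j => mxnorm1 (deval delta (Z j) - deval delta T) * Num.sqrt M)).
- apply: nearW => j; rewrite hten_norm_ge0/= -(realization_pencil _ (GZ j)) pencilB.
  apply: (le_trans (hten_norm_D_idE_tens Dle _ _)).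
  by apply: ler_pM; rewrite ?opnorm_ge0 ?hten_norm_ge0// opnorm_le_mxnorm1.
- exact: cvg_cst.
- by rewrite -(mul0r (Num.sqrt M)); exact: cvgMl.
Qed.

(** Approach T along Z j = T + t j H with H inward and t j tending to 0. There
    1 - |delta(Z j)|^2 >= c t j, while delta(Z j) is within K' t j of delta(T);
    solving for u(Z j) - v costs at most a factor 1 / (1 - |delta(Z j)|), so
    u(Z j) stays bounded. Both the numerator and the denominator of the B-point
    quotient are then of order t j, and a subsequence of the quotients
    converges. *)
Lemma in_Ran_B_point n (T : mtuple R d n) : Idelta delta T ->
  inward delta T !=set0 ->
  in_Ran (C_tens C : 'cV_n -> hten E J n) (pencil D (deval delta T)) ->
  B_point delta phi T.
Proof.
move=> TI [H [_ Hneg]] [v vE]; have [TB Tiso] := TI.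
have n0 := Idelta_dim_gt0 TI.
have [N [K [K0 tay]]] := deval_taylor delta T H.
move: Hneg; rewrite (nabla_taylor K0 tay) => Nneg.
have [t0 [c [K' [t0_gt0 t01 c0 K'0 est]]]] :=
  inward_estimate (isometry_adjmx Tiso) Nneg K0.
pose t j := t0 * j.+1%:R^-1.
have t_gt0 j : 0 < t j by rewrite mulr_gt0// invr_gt0.
have t_le j : t j <= t0 by rewrite ler_piMr ?(ltW t0_gt0)// invf_le1 ?ler1n.
have t_le1 j : t j <= 1 := le_trans (t_le j) t01.
pose Z j : mtuple R d n := fun r => T r + (t j)%:C%C *: H r.
have ZX j : [/\ c * t j <= 1 - opnorm (deval delta (Z j)) ^+ 2,
    opnorm (deval delta (Z j)) < 1,
    mxnorm1 (1%:M - (deval delta (Z j)) ^t* *m deval delta (Z j)) <= K' * t j &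
    mxnorm1 (deval delta (Z j) - deval delta T) <= K' * t j].
  have [|Q [ZE QK]] := tay (t j)%:C%C.
    by rewrite absRE absR_real ?lecR// ltW.
  rewrite {}/Z ZE; exact: est.
have GZ j : Gdelta delta (Z j) by have [_ ? _ _] := ZX j.
pose r k := hten_norm (v (delta_mx k 0))
            + 2 * K' / c * hten_norm (v (delta_mx k 0)).
have ur j k : hten_norm (u (Z j) (delta_mx k 0)) <= r k.
  have [ct q1 _ XT] := ZX j.
  set X := deval delta (Z j) in ct q1 XT *.
  set w := u (Z j) _; set vk := v (delta_mx k 0).
  pose y := w - vk.
  (* Subtract the equation for v at T from the one for w at Z j. *)
  have yE : y = D_tens D (idE_tens X y + idE_tens (X - deval delta T) vk).
    have := vE (delta_mx k 0); rewrite -(realization_pencil _ (GZ j)) -/w -/vk -/X.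
    rewrite /pencil /y idE_tensB [idE_tens X (w - vk)]linearB/= addrA subrK.
    rewrite [D_tens D (_ - _)]linearB/=.
    move: (D_tens D _) (D_tens D _) => a b h.
    have -> : w = vk - b + a by rewrite h subrK.
    by rewrite [LHS]addrC !addrA addNr add0r addrC.
  (* D is a contraction, so y is controlled by the right-hand side of yE. *)
  have ybound : (1 - opnorm X) * hten_norm y <= K' * t j * hten_norm vk.
    rewrite mulrBl mul1r lerBlDr {1}yE.
    apply: (le_trans (hten_norm_D_tens _ Dle)); apply: (le_trans (hten_normD _ _)).
    rewrite addrC; apply: lerD; last exact: hten_norm_idE_tens.
    apply: (le_trans (hten_norm_idE_tens _ _)); rewrite ler_wpM2r ?hten_norm_ge0//.
    exact: le_trans (opnorm_le_mxnorm1 _) XT.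
  have q2 : c * t j <= 2 * (1 - opnorm X).
    apply: (le_trans ct).
    have -> : 1 - opnorm X ^+ 2 = (1 + opnorm X) * (1 - opnorm X) by ring.
    apply: ler_wpM2r; first by rewrite subr_ge0 ltW.
    by move: q1; move: (opnorm X) => a; lra.
  have hy : hten_norm y <= 2 * K' / c * hten_norm vk.
    rewrite mulrAC ler_pdivlMr// -(ler_pM2r (t_gt0 j)).
    have := ler_wpM2r (hten_norm_ge0 y) q2; move: ybound.
    move: (hten_norm y) (hten_norm vk) (opnorm X) (t j) => a b q s; lra.
  have -> : w = vk + y by rewrite /y addrC subrK.
  by apply: (le_trans (hten_normD _ _)); rewrite lerD2l.
pose ratio j := opnorm (1%:M - (phi (Z j)) ^t* *m phi (Z j))
                       / (1 - opnorm (deval delta (Z j)) ^+ 2).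
have ratio_ge0 j : 0 <= ratio j.
  have [ct _ _ _] := ZX j; rewrite divr_ge0 ?opnorm_ge0//.
  by apply: le_trans ct; rewrite mulr_ge0 ?ltW.
have ratio_le j : ratio j <= K' * (\sum_k r k) ^+ 2 / c.
  have [ct _ XX _] := ZX j.
  have ct0 : 0 < c * t j by rewrite mulr_gt0.
  rewrite /ratio ler_pdivrMr ?(lt_le_trans ct0 ct)//.
  apply: le_trans (_ : K' * (\sum_k r k) ^+ 2 / c * (c * t j) <= _); last first.
    rewrite ler_wpM2l//; apply: divr_ge0 (ltW c0).
    exact: mulr_ge0 (sqr_ge0 _).
  apply: (le_trans (opnorm_defect u_model (GZ j) (ur j))).
  rewrite mulrA divfK ?gt_eqF// mulrAC ler_wpM2r ?sqr_ge0//.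
have [|f fincr fcvg] := @bolzano_weierstrass R ratio.
  exists (K' * (\sum_k r k) ^+ 2 / c); split; first exact: num_real.
  move=> M MK j _ /=; rewrite ger0_norm//; exact: le_trans (ratio_le j) (ltW MK).
split=> //; exists (Z \o f); split=> [j||//]; first exact: GZ.
have f_ge j : (j <= f j)%N.
  elim: j => // j IHj; apply: leq_ltn_trans IHj _.
  by have /increasing_seqP := fincr; apply.
apply/tuple_cvg => r'.
apply: (@mxcvg_le _ _ _ _ _ (fun j => j.+1%:R^-1 * mxnorm1 (H r'))).
  move=> j; rewrite /Z/= addrC addKr mxnorm1Z absR_real; last exact: ltW.
  rewrite ler_wpM2r ?mxnorm1_ge0// /t -[leRHS]mul1r.
  apply: ler_pM => //; first exact: ltW.
  by rewrite lef_pV2 ?posrE ?ltr0n// ler_nat ltnS.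
by rewrite -(mul0r (mxnorm1 (H r'))); apply: cvgMl; exact: cvg_harmonic.
Qed.

End realized_model.

Theorem theorem4p17 (R : realType) (d J : nat) (delta : 'M[ncpoly R d]_J)
    (phi : gradedfun R d) (phiS : schur_class delta phi)
    (E : hilbertType R) (u : hgradedfun d E J) (u_model : nc_model delta phi u)
    (A : R[i]) (B : {scalar hvec E J}) (C : {linear R[i]^o -> hvec E J})
    (D : {linear hvec E J -> hvec E J})
    (ABCD : realization delta phi u A B C D)
    (n : nat) (T : mtuple R d n) (TI : Idelta delta T)
    (T_inward : inward delta T !=set0) :
  B_point delta phi T <->
  in_Ran (C_tens C)
    (fun v : hten E J n => v - D_tens D (idE_tens (deval delta T) v)).
Proof.
split; first exact: (B_point_in_Ran u_model ABCD).
exact: (in_Ran_B_point u_model ABCD TI T_inward).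
Qed.
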